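(* Let $Y$ be a Banach space. Then the following assertions are equivalent. (1) $Y$ is infinite dimensional. (2) There exists a JN-sequence in $Y^*$. (3) There exist a convex, norm separable and weak$^*$ compact metrizable subset $K$ of $Y^*$ containing $0$ and a continuous seminorm $h$ on $Y^*$ which is weak$^*$ lower semicontinuous and weak$^*$ sequentially continuous, such that the restriction $h_{|K}$ has a weak$^*$-strong minimum but not a norm-strong minimum at $0$. (4) There exist a Banach space $X$ and a linear continuous non-limited operator $T: Y\longrightarrow X$. (5) There exists on $Y$ a convex continuous PGNF-function.
   Context: Banach spaces are real. A JN-sequence in the dual $Y^*$ of a Banach space $Y$ is a sequence $(p_n)_n$ in $Y^*$ that is weak$^*$ null and satisfies $\inf_n\|p_n\|>0$. A real-valued function $g$ defined on a dual space $Y^*$ (or on a subset $K$ of it) has a norm-strong minimum (resp. weak$^*$-strong minimum) at a point $p$ of its domain if $g(p)=\inf g$ (infimum over the domain) and every sequence $(p_n)_n$ in the domain with $g(p_n)\to g(p)$ norm converges (resp. weak$^*$ converges) to $p$. A subset $K$ of $Y^*$ is weak$^*$ compact metrizable if it is compact and metrizable for the topology induced on it by the weak$^*$ topology. A subset $A$ of a Banach space $X$ is called limited if every weak$^*$ null sequence $(p_n)_n$ in $X^*$ satisfies $\lim_{n\to+\infty}\sup_{x\in A}|\langle p_n,x\rangle|=0$. A bounded linear operator $T:Y\longrightarrow X$ is called limited if it maps the closed unit ball of $Y$ to a limited subset of $X$; non-limited means not limited. A real-valued function $f$ on a Banach space is called a PGNF-function if there exists a point at which $f$ is Gâteaux differentiable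 but not Fréchet differentiable. *)

(* Defs.v *)
From HB Require Import structures.
From mathcomp Require Import all_boot all_order all_algebra.
From mathcomp Require Import all_classical all_reals all_analysis.

Set Implicit Arguments.
Unset Strict Implicit.
Unset Printing Implicit Defensive.

Import Order.TTheory GRing.Theory Num.Theory.
Import numFieldNormedType.Exports.

Local Open Scope classical_set_scope.
Local Open Scope ring_scope.

(* Real Banach spaces are [completeNormedModType R] with [R : realType]. *)

Definition unit_ball (R : realType) (Y : normedModType R) : set Y :=
  [set x | `|x| <= 1].
Arguments unit_ball {R} Y.

Section Dual.
Context (R : realType) (Y : normedModType R).

Definition continuous_linear : {pred Y -> R^o} :=
  [pred f : Y -> R^o | `[< linear f /\ continuous f >]].

Record dual := Dual {
  dual_fun :> Y -> R^o;
  dual_funP : dual_fun \in continuous_linear }.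

HB.instance Definition _ := [isSub for dual_fun].
HB.instance Definition _ := [Choice of dual by <:].

Lemma continuous_linear_submod_closed : submod_closed continuous_linear.
Proof.
split; first by apply/asboolP; split; [move=> a x y; rewrite scaler0 addr0|
  exact: cst_continuous].
move=> a f g /asboolP[lf cf] /asboolP[lg cg]; apply/asboolP; split.
  move=> b x y.
  rewrite -[LHS]/(a *: f (b *: x + y) + g (b *: x + y)).
  rewrite -[RHS]/(b *: (a *: f x + g x) + (a *: f y + g y)).
  rewrite lf lg !scalerDr !scalerA (mulrC a b) -!addrA; congr (_ + _).
  by rewrite addrCA.
by move=> x; apply: (@cvgD R R^o); [apply: (@cvgZl_tmp R R^o); exact: cf|exact: cg].
Qed.

HB.instance Definition _ := GRing.isSubmodClosed.Build _ _ continuous_linear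
  continuous_linear_submod_closed.
HB.instance Definition _ := [SubChoice_isSubLmodule of dual by <:].

Lemma dual_linear (p : dual) : linear p.
Proof. by have /asboolP[] := dual_funP p. Qed.

Lemma dual_continuous (p : dual) : continuous p.
Proof. by have /asboolP[] := dual_funP p. Qed.

HB.instance Definition _ (p : dual) :=
  GRing.isLinear.Build R Y R^o _ (dual_fun p) (dual_linear p).

Definition dual_norm (p : dual) : R := sup [set `|p x| | x in unit_ball Y].

Lemma dual_norm_has_sup (p : dual) : has_sup [set `|p x| | x in unit_ball Y].
Proof.
split; first by exists `|p 0|, 0 => //; rewrite /unit_ball/= normr0.
have /linear_boundedP : bounded_near (dual_fun p) (nbhs (0 : Y)).
  exact/continuous_linear_bounded/dual_continuous.
move=> /pinfty_ex_gt0[M M0 pM]; exists M => _ [x x1 <-].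
by rewrite (le_trans (pM x))// ler_piMr// ltW.
Qed.

Lemma dual_norm_ub (p : dual) x : unit_ball Y x -> `|p x| <= dual_norm p.
Proof.
by move=> x1; apply: ub_le_sup; [exact: (dual_norm_has_sup p).2|exists x].
Qed.

Lemma dual_norm_le (p : dual) (M : R) :
  (forall x, unit_ball Y x -> `|p x| <= M) -> dual_norm p <= M.
Proof.
move=> pM; apply: ge_sup; first exact: (dual_norm_has_sup p).1.
by move=> _ [x x1 <-]; exact: pM.
Qed.

Lemma ler_dual_normD (p q : dual) : dual_norm (p + q) <= dual_norm p + dual_norm q.
Proof.
apply: dual_norm_le => x x1.
by rewrite (le_trans (ler_normD (p x) (q x)))// lerD// dual_norm_ub.
Qed.

Lemma dual_normZ (a : R) (p : dual) : dual_norm (a *: p) = `|a| * dual_norm p.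
Proof.
have leZ b (q : dual) : dual_norm (b *: q) <= `|b| * dual_norm q.
  apply: dual_norm_le => x x1; rewrite -[(b *: q) x]/(b * q x) normrM.
  by rewrite ler_wpM2l// dual_norm_ub.
apply/eqP; rewrite eq_le leZ/=.
have [->|a0] := eqVneq a 0.
  rewrite normr0 mul0r scale0r; apply: le_trans (@dual_norm_ub _ 0 _) => //.
  by rewrite /unit_ball/= normr0.
rewrite -ler_pdivlMl ?normr_gt0// -normfV.
by rewrite (le_trans _ (leZ _ _))// scalerA mulVf// scale1r.
Qed.

Lemma dual_norm0_eq0 (p : dual) : dual_norm p = 0 -> p = 0.
Proof.
move=> p0; apply/val_inj/funext => x /=.
have [->|x0] := eqVneq x 0; first by rewrite linear0.
have : `|p (`|x|^-1 *: x)| <= 0.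
  rewrite -p0 dual_norm_ub// /unit_ball/= normrZ normfV normr_id.
  by rewrite mulVf// normr_eq0.
rewrite normr_le0 linearZ/= => /eqP/(congr1 (fun r => `|x| * r)).
by rewrite mulr0 mulVKf// normr_eq0.
Qed.

HB.instance Definition _ := Lmodule_isNormed.Build R dual
  ler_dual_normD dual_normZ dual_norm0_eq0.

(* The alias [weakstar] of [dual] carries the weak* topology; the topology of
   [dual] itself is that of the norm [dual_norm]. *)
Definition weakstar : Type :=
  initial_topology (fun p : dual => (dual_fun p : {ptws Y -> R^o})).

HB.instance Definition _ := Topological.on weakstar.

Lemma weakstar_cvgP (p : nat -> dual) (q : dual) :
  (p : nat -> weakstar) @ \oo --> (q : weakstar) <->
  forall y, p n y @[n --> \oo] --> q y.
Proof.
pose ev (r : weakstar) : {ptws Y -> R^o} := dual_fun r.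
split=> [pq y|pq A [B [[C oC <-] Cq BA]]].
  have pq' : {ptws, (fun n => dual_fun (p n)) @ \oo --> dual_fun q}.
    apply: (@cvg_comp _ _ _ (p : nat -> weakstar) ev); first exact: pq.
    exact: (@initial_continuous _ {ptws Y -> R^o} ev).
  exact: ((pointwise_cvgP _ _).1 pq').
have pq' : {ptws, (fun n => dual_fun (p n)) @ \oo --> dual_fun q}.
  by apply/pointwise_cvgP.
have : nbhs (dual_fun q : {ptws Y -> R^o}) C by exact: open_nbhs_nbhs.
by move=> /pq' [N _ NC]; exists N => // n /NC ?; exact: BA.
Qed.

End Dual.

Definition infinite_dimensional (R : realType) (Y : lmodType R) :=
  ~ exists (n : nat) (b : 'I_n -> Y),
      forall y, exists c : 'I_n -> R, y = \sum_(i < n) c i *: b i.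

Section WeakStar.
Context (R : realType) (Y : normedModType R).

Definition weakstar_null (p : nat -> dual Y) :=
  (p : nat -> weakstar Y) @ \oo --> ((0 : dual Y) : weakstar Y).

Definition JN_sequence (p : nat -> dual Y) :=
  weakstar_null p /\ 0 < inf [set `|p n| | n in [set: nat]].

Definition norm_separable (K : set (dual Y)) :=
  exists2 D : set (dual Y), countable D & D `<=` K /\ K `<=` closure D.

Definition seminorm (h : dual Y -> R) :=
  (forall p q, h (p + q) <= h p + h q) /\
  (forall (a : R) p, h (a *: p) = `|a| * h p).

Definition weakstar_lower_semicontinuous (h : dual Y -> R) :=
  lower_semicontinuous (fun p : weakstar Y => (h p)%:E).

Definition weakstar_sequentially_continuous (h : dual Y -> R) :=
  forall (p : nat -> dual Y) (q : dual Y),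
    (p : nat -> weakstar Y) @ \oo --> (q : weakstar Y) ->
    h (p n) @[n --> \oo] --> h q.

End WeakStar.

(* [A] is metrizable for the topology induced by [T]: the trace on [A] of the
   neighborhoods of a point is generated by the open [d]-balls of [A]. *)
Definition metrizable_set (R : realType) (T : topologicalType) (A : set T) :=
  exists d : T -> T -> R,
    [/\ forall x y, A x -> A y -> d x y = 0 <-> x = y,
        forall x y, A x -> A y -> d x y = d y x,
        forall x y z, A x -> A y -> A z -> d x z <= d x y + d y z
      & forall x, A x -> within A (nbhs x) =
          filter_from [set e : R | 0 < e]
            (fun e => A `&` [set y | d x y < e])].

Definition weakstar_compact_metrizable (R : realType) (Y : normedModType R)
    (K : set (dual Y)) :=
  compact (K : set (weakstar Y)) /\
  metrizable_set R (K : set (weakstar Y)).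

(* [g] restricted to [K] has a strong minimum at [p] for the topology of [T]. *)
Definition strong_minimum (R : realType) (T : topologicalType) (K : set T)
    (g : T -> R) (p : T) :=
  [/\ K p,
      (g p)%:E = ereal_inf [set (g q)%:E | q in K]
    & forall q : nat -> T, (forall n, K (q n)) ->
        g (q n) @[n --> \oo] --> g p -> q @ \oo --> p].

Definition norm_strong_minimum (R : realType) (Y : normedModType R)
    (K : set (dual Y)) (g : dual Y -> R) (p : dual Y) :=
  strong_minimum K g p.

Definition weakstar_strong_minimum (R : realType) (Y : normedModType R)
    (K : set (dual Y)) (g : dual Y -> R) (p : dual Y) :=
  @strong_minimum R (weakstar Y) K g p.

(* The supremum is taken in [\bar R], hence is [-oo] when [A] is empty; below
   [A] is always the image of a unit ball. *)
Definition limited_set (R : realType) (X : normedModType R) (A : set X) :=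
  forall p : nat -> dual X, weakstar_null p ->
    ereal_sup [set `|p n x|%:E | x in A] @[n --> \oo] --> 0%E.

Definition limited_operator (R : realType) (Y X : normedModType R)
    (T : Y -> X) :=
  limited_set (T @` unit_ball Y).

Definition Gateaux_differentiable (R : realType) (Y : normedModType R)
    (f : Y -> R^o) (x : Y) :=
  exists p : dual Y, forall v : Y, is_derive x v f (p v).

Definition PGNF (R : realType) (Y : normedModType R) (f : Y -> R^o) :=
  exists x : Y, Gateaux_differentiable f x /\ ~ differentiable f x.

(* Main.v *)
From HB Require Import structures.
Require Import Defs.
From mathcomp Require Import all_boot all_order all_algebra.
From mathcomp Require Import all_classical all_reals all_analysis.
From mathcomp Require Import ring lra.

Set Implicit Arguments.
Unset Strict Implicit.
Unset Printing Implicit Defensive.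

Import Order.TTheory GRing.Theory Num.Theory.
Import numFieldNormedType.Exports.

Local Open Scope classical_set_scope.
Local Open Scope ring_scope.

(** The heart of the matter is the Josefson--Nissenzweig theorem: the dual of an
infinite-dimensional space contains a JN-sequence.

Let Y be infinite dimensional. Norming functionals ([norming_functional], by Zorn's
lemma on minimal sublinear functionals) give a sequence f in the unit ball of the
dual with |f m - f n| >= 1 for m <> n ([dual_separated_sequence]). Rosenthal's
dichotomy ([convergent_or_oscillating], [oscillating_independent]) leaves two cases.
If a subsequence converges pointwise on the unit ball, differences of its terms form
a JN-sequence. Otherwise there are reals r < s and functionals a_0, a_1, ... in the
unit ball of the dual such that every finite pattern of conditions a_i <= r, a_i >=
s is realized in the unit ball of Y; testing on pairs of opposite patterns shows
that (a_i) is equivalent to the unit basis of l1 ([independent_l1]).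

In the second case the argument is that of Hagler and Johnson ([l1_sequence_null]).
Coefficient vectors are polynomials, with the l1 norm. A block of a sequence u is a
sequence of vectors of norm 1 eventually lying in the symmetric midpoint-convex hull
of each tail of u, and the size of u is the supremum over the unit ball of limsup |T
(u n) x|, where T sends a coefficient vector to the corresponding combination of the
a_i. The size decreases along blocks, so a diagonal argument ([refines_stable])
provides a u whose size d is that of all its blocks. If d = 0, the functionals T (u
n) form a JN-sequence. If d > 0, then averaging terms with disjoint supports, taken
with both signs from finitely many blocks of u, must again give size d; since no
term exceeds d by much, one vector x makes all the terms of the average nearly
extremal at once ([tree_step]). This yields vectors x_n and a dyadic tree of blocks
on whose branches the values at x_n are at least d / 2 with prescribed signs. The
Rademacher averages over the N-th level of the tree satisfy Bessel's inequality
([word_Bessel]); their limits q_n along an ultrafilter in N satisfy q_n x_n >= d / 2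
and sum_n (q_n x)^2 <= |x|^2, so they form a JN-sequence ([stable_blocks_null]).

The remaining implications are softer.

From JN-sequences to minima. For a normalized JN-sequence (p_n), let K be the set of
all sums of a_n p_n with a_n >= 0 and sum a_n <= 1. It is weak* compact since the
coefficients converge along ultrafilters and p_n tends to 0 pointwise, and norm
separable since rational coefficients are dense. Hence some sequence (z_n), which
may be taken to tend to 0 in norm, separates K, and h(p) = sup_n |p z_n| is a weak*
sequentially continuous seminorm (by uniform boundedness) for which h(p - q)
metrizes K. It tends to 0 along (p_n), whose norms are 1.

From minima to operators. A sequence of K witnessing that 0 is not a norm-strong
minimum is weak* null and not norm null, so the identity of Y is not limited.

From operators to PGNF-functions. A non-limited operator has an adjoint mapping some
weak* null sequence to a sequence that is not norm null; this gives a JN-sequence,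
and for a normalized one (q_n) the function sup_n (|q_n| - 1/(n+1)) is Gateaux but
not Frechet differentiable at 0 ([normalized_null_PGNF]).

From PGNF-functions to dimension. In finite dimension a convex function is
controlled near a point by its values along coordinate lines, so Gateaux
differentiability implies Frechet differentiability ([convex_Gateaux_Frechet]). *)

(** * The dual of a normed space; the Hahn--Banach theorem *)

Section DualBasics.
Context (R : realType) (Y : normedModType R).
Implicit Types (p q : dual Y) (x y : Y).

Lemma dualDE p q x : (p + q) x = p x + q x :> R. Proof. by []. Qed.
Lemma dualNE p x : (- p) x = - p x :> R. Proof. by []. Qed.
Lemma dualBE p q x : (p - q) x = p x - q x :> R. Proof. by []. Qed.
Lemma dualZE (a : R) p x : (a *: p) x = a * p x :> R. Proof. by []. Qed.
Lemma dual0E x : (0 : dual Y) x = 0 :> R. Proof. by []. Qed.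

Lemma dual_sumE (I : Type) (r : seq I) (P : pred I) (F : I -> dual Y) x :
  (\sum_(i <- r | P i) F i) x = \sum_(i <- r | P i) (F i x : R) :> R.
Proof. by elim/big_rec2: _ => // i u v _ <-. Qed.

Lemma dual_addr p x y : p (x + y) = p x + p y :> R.
Proof. exact: linearD. Qed.
Lemma dual_scaler p (a : R) x : p (a *: x) = a * p x :> R.
Proof. exact: linearZ. Qed.
Lemma dual_oppr p x : p (- x) = - p x :> R.
Proof. exact: linearN. Qed.
Lemma dual_subr p x y : p (x - y) = p x - p y :> R.
Proof. exact: linearB. Qed.

Lemma ler_dual p x : `|p x : R| <= `|p| * `|x|.
Proof.
have [->|x0] := eqVneq x 0; first by rewrite linear0 !normr0 mulr0.
have nx0 : 0 < `|x| by rewrite normr_gt0.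
rewrite -ler_pdivrMr//.
have : `|p (`|x|^-1 *: x)| <= dual_norm p.
  apply: dual_norm_ub; rewrite /unit_ball/= normrZ normfV normr_id.
  by rewrite mulVf// gt_eqF.
by rewrite dual_scaler normrM normfV normr_id mulrC.
Qed.

Lemma ler_dual_unit p x : `|x| <= 1 -> `|p x : R| <= `|p|.
Proof. exact: dual_norm_ub. Qed.

Lemma dual_norm_leP p (M : R) :
  (forall x, `|x| <= 1 -> `|p x : R| <= M) -> `|p| <= M.
Proof. exact: dual_norm_le. Qed.

Lemma dual_norm_ltP p (M : R) :
  M < `|p| -> exists2 x, `|x| <= 1 & M < `|p x : R|.
Proof.
move=> Mp; apply: contrapT => /forall2NP h; move: Mp; apply/negP; rewrite -leNgt.
apply: dual_norm_leP => x x1; rewrite leNgt; apply/negP => Mx.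
by have [|] := h x.
Qed.

(** A bounded linear form is an element of the dual. *)
Lemma bounded_form_dual (f : Y -> R) (C : R) : 0 <= C ->
  (forall x y, f (x + y) = f x + f y) ->
  (forall a x, f (a *: x) = a * f x) ->
  (forall x, `|f x| <= C * `|x|) ->
  exists2 p : dual Y, (forall x, p x = f x) & `|p| <= C.
Proof.
move=> C0 fD fZ fC.
have lf : linear (f : Y -> R^o) by move=> a x y; rewrite fD fZ.
pose F : {linear Y -> R^o} := HB.pack (f : Y -> R^o)
  (GRing.isLinear.Build R Y R^o _ (f : Y -> R^o) lf).
have cF : continuous F.
  apply: bounded_linear_continuous; apply/linear_boundedP.
  exists C; split; first exact: num_real.
  by move=> r Cr x; rewrite (le_trans (fC x))// ler_wpM2r// ltW.
have Fd : (f : Y -> R^o) \in @continuous_linear R Y.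
  by apply/asboolP; split=> // y; exact: (cF y).
exists (Dual Fd) => //; apply: dual_norm_leP => x x1 /=.
by rewrite (le_trans (fC x))// ler_piMr.
Qed.

End DualBasics.

Section HahnBanach.
Context (R : realType) (Y : normedModType R).
Implicit Types (x y : Y).

(** Subadditive and positively homogeneous functionals. *)
Definition sublinear (s : Y -> R) :=
  (forall x y, s (x + y) <= s x + s y) /\
  (forall t x, 0 <= t -> s (t *: x) = t * s x).

(** Sublinear functionals dominated by the norm. *)
Definition norm_sublinear (s : Y -> R) :=
  sublinear s /\ forall x, s x <= `|x|.

Lemma norm_sublinear_ge s x : norm_sublinear s -> - `|x| <= s x.
Proof.
move=> [[sD sZ] sn].
have s0 : s 0 = 0 by rewrite -[X in s X](scale0r (0 : Y)) sZ// mul0r.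
have := sD x (- x); rewrite subrr s0 => h.
by have := sn (- x); rewrite normrN; lra.
Qed.

Lemma norm_sublinear_norm : norm_sublinear (fun x => `|x|).
Proof.
split=> //; split; first exact: ler_normD.
by move=> t x t0; rewrite normrZ ger0_norm.
Qed.

(** The infimum of a directed family of functionals that is sublinear up to changing
the index; it covers both infima of chains and the functionals below. *)
Lemma inf_sublinear (I : Type) (F : I -> Y -> R) (i0 : I) :
  (forall i x, - `|x| <= F i x) ->
  (forall i j x y, exists k, F k (x + y) <= F i x + F j y) ->
  (forall i t x, 0 < t -> exists j, F j (t *: x) <= t * F i x) ->
  (forall x, exists i, F i x <= `|x|) ->
  exists2 s, norm_sublinear s & forall i x, s x <= F i x.
Proof.
move=> Fge FD FZ Fn.
pose E x := [set F i x | i in [set: I]].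
have Elb x : has_lbound (E x).
  by exists (- `|x|) => _ [i _ <-].
have E0 x : E x !=set0 by exists (F i0 x), i0.
pose s x := inf (E x).
have sle i x : s x <= F i x by apply: ge_inf => //; exists i.
have sge x (M : R) : (forall i, M <= F i x) -> M <= s x.
  by move=> h; apply: lb_le_inf => // _ [i _ <-].
have seps x e : 0 < e -> exists i, F i x < s x + e.
  move=> e0; have [_ [i _ <-] h] := inf_adherent e0 (conj (E0 x) (Elb x)).
  by exists i.
have sZ1 t x : 0 < t -> s (t *: x) <= t * s x.
  move=> t0; rewrite -ler_pdivrMl//; apply: sge => i.
  have [j Fj] := FZ i t x t0.
  by rewrite ler_pdivrMl// (le_trans (sle j _)).
have sn x : s x <= `|x|.
  by have [i Fi] := Fn x; rewrite (le_trans (sle i _)).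
exists s => //; split=> //; split.
  move=> x y; apply/ler_addgt0Pr => e e0.
  have e2 : 0 < e / 2 by lra.
  have [i Fi] := seps x _ e2.
  have [j Fj] := seps y _ e2.
  have [k Fk] := FD i j x y.
  have := sle k (x + y); lra.
move=> t x; rewrite le_eqVlt => /predU1P[<-|t0].
  rewrite scale0r mul0r; apply/eqP; rewrite eq_le; apply/andP; split.
    by have := sn 0; rewrite normr0.
  by apply: sge => i; have := Fge i 0; rewrite normr0 oppr0.
apply/eqP; rewrite eq_le sZ1//=.
have := sZ1 t^-1 (t *: x); rewrite scalerA mulVf ?gt_eqF// scale1r invr_gt0.
by move=> /(_ t0); rewrite ler_pdivlMl.
Qed.

(** For every x0 the functional inf over t >= 0 of s (x + t x0) - t s x0 is
again sublinear; applied to a minimal s, it forces s to be linear. *)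
Lemma sublinear_push s x0 : norm_sublinear s ->
  exists2 s', norm_sublinear s' &
    (forall x, s' x <= s x) /\ s' (- x0) <= - s x0.
Proof.
move=> ns; have [[sD sZ] sn] := ns.
pose F (t : {t : R | 0 <= t}) x := s (x + val t *: x0) - val t * s x0.
have [||||s' ns' s'F] := @inf_sublinear _ F (exist _ 0 (lexx 0)).
- move=> [t t0] x; rewrite /F/=.
  have := sD (x + t *: x0) (- x); rewrite addrAC subrr add0r sZ//.
  have := sn (- x); rewrite normrN; lra.
- move=> [t t0] [u u0] x y; exists (exist _ (t + u) (addr_ge0 t0 u0)).
  rewrite /F/= scalerDl addrACA mulrDl.
  have := sD (x + t *: x0) (y + u *: x0); lra.
- move=> [t t0] a x a0; exists (exist _ (a * t) (mulr_ge0 (ltW a0) t0)).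
  by rewrite /F/= -scalerA -scalerDr sZ ?(ltW a0)// mulrBr mulrA.
- move=> x; exists (exist _ 0 (lexx 0)).
  by rewrite /F/= scale0r addr0 mul0r subr0.
exists s' => //; split.
  move=> x; have := s'F (exist _ 0 (lexx 0)) x.
  by rewrite /F/= scale0r addr0 mul0r subr0.
have := s'F (exist _ 1 ler01) (- x0).
rewrite /F/= scale1r addNr mul1r.
by rewrite -[X in s X](scale0r (0 : Y)) sZ// mul0r sub0r.
Qed.

(** Zorn's lemma for the reverse pointwise order. *)
Lemma minimal_sublinear s0 : norm_sublinear s0 ->
  exists2 s, norm_sublinear s & (forall x, s x <= s0 x) /\
    forall s', norm_sublinear s' -> (forall x, s' x <= s x) -> s' = s.
Proof.
move=> ns0.
pose T := {s : Y -> R | norm_sublinear s /\ forall x, s x <= s0 x}.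
pose Rel (s t : T) := `[< forall x, sval t x <= sval s x >].
have [|||A totA|[s [ns ss0]] smin] := @Zorn T Rel.
- by move=> t; apply/asboolP.
- move=> r s t /asboolP rs /asboolP st; apply/asboolP => x.
  by rewrite (le_trans (st x)).
- move=> [s ps] [t pt] /asboolP/= st /asboolP/= ts.
  apply: eq_exist => /=; apply/funext => x; apply/eqP; rewrite eq_le.
  by rewrite ts st.
- have [[a Aa]|A0] := pselect (exists a, A a); last first.
    exists (exist _ s0 (conj ns0 (fun x => lexx _))) => s As.
    by exfalso; apply: A0; exists s.
  pose F (i : {t : T | A t}) := sval (sval i).
  have nF i : norm_sublinear (F i) by case: i => -[s [? ?]] ?.
  have [||||s ns sF] := @inf_sublinear _ F (exist _ a Aa).
  + by move=> i x; exact: norm_sublinear_ge.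
  + move=> i j x y.
    have [/asboolP ij|/asboolP ij] := totA _ _ (svalP i) (svalP j).
      exists j; rewrite (le_trans ((nF j).1.1 _ _))// lerD2r; exact: ij.
    exists i; rewrite (le_trans ((nF i).1.1 _ _))// lerD2l; exact: ij.
  + by move=> i t x t0; exists i; rewrite (nF i).1.2// ltW.
  + by move=> x; exists (exist _ a Aa); exact: (nF _).2.
  have ss0 x : s x <= s0 x.
    apply: (le_trans (sF (exist _ a Aa) x)).
    by rewrite /F/=; case: (a) => ? [].
  exists (exist _ s (conj ns ss0)) => t At; apply/asboolP => x /=.
  exact: (sF (exist _ t At)).
exists s => //; split=> // s' ns' s's.
have s's0 x : s' x <= s0 x by rewrite (le_trans (s's x)).
have /(_ _)/(congr1 sval) := smin (exist _ s' (conj ns' s's0)).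
by apply; apply/asboolP.
Qed.

(** Hahn--Banach: every vector is normed by a functional of norm at most 1. *)
Lemma norming_functional x0 :
  exists2 p : dual Y, `|p| <= 1 & p x0 = `|x0| :> R.
Proof.
have [s0 ns0 [_ s0x0]] := sublinear_push x0 norm_sublinear_norm.
have [s ns [ss0 smin]] := minimal_sublinear ns0.
have [[sD sZ] sn] := ns.
(* minimality gives s (- x) <= - s x, hence oddness and additivity *)
have sN x : s (- x) = - s x.
  have [s' ns' [s's s'x]] := sublinear_push x ns.
  move: s'x; rewrite (smin _ ns' s's) => h.
  apply/eqP; rewrite eq_le h/=.
  have := sD x (- x); rewrite subrr -[X in s X](scale0r (0 : Y)) sZ// mul0r; lra.
have sA x y : s (x + y) = s x + s y.
  apply/eqP; rewrite eq_le sD/=.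
  have := sD (x + y) (- y); rewrite addrK sN; lra.
have sZ' a x : s (a *: x) = a * s x.
  have [a0|a0] := leP 0 a; first exact: sZ.
  by rewrite -[a]opprK scaleNr sN sZ ?mulNr ?opprK // oppr_ge0 ltW.
have [|p ps pn] := @bounded_form_dual R Y s 1 ler01 sA sZ'.
  move=> x; rewrite mul1r ler_norml sn norm_sublinear_ge//.
exists p => //; rewrite ps; apply/eqP; rewrite eq_le sn/=.
by have := le_trans (ss0 _) s0x0; rewrite sN lerN2.
Qed.

End HahnBanach.

(** * Finite rank, and separated sequences in the dual *)

Section FiniteDimension.
Context (R : realType) (Y : normedModType R).
Implicit Types (s : seq (dual Y)) (L : seq (dual Y * Y)).

(** A finite-rank operator, given by the functionals and vectors of L. *)
Definition finite_rank L (v : Y) : Y := \sum_(c <- L) (c.1 v : R) *: c.2.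

Lemma finite_rank_dual L (p : dual Y) :
  exists q : dual Y, forall v, q v = p (finite_rank L v) :> R.
Proof.
elim: L => [|c L [q qE]]; first by exists 0 => v; rewrite /finite_rank big_nil linear0.
exists ((p c.2 : R) *: c.1 + q) => v.
rewrite /finite_rank big_cons dual_addr dual_scaler -/(finite_rank L v) -qE.
by rewrite dualDE dualZE mulrC.
Qed.

(** Gram--Schmidt: modulo the common kernel of finitely many functionals, the
identity has finite rank, with continuous coordinates. *)
Lemma common_kernel_finite_rank s :
  exists L, forall v, {in s, forall p : dual Y, p v = p (finite_rank L v) :> R}.
Proof.
elim: s => [|p s [L LE]]; first by exists [::] => v p; rewrite in_nil.
have [h|] := pselect (forall v, p v = p (finite_rank L v) :> R).
  by exists L => v q; rewrite inE => /predU1P[->//|]; exact: LE.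
move=> /existsNP[w /eqP pw].
pose u := w - finite_rank L w.
have pu : p u != 0 :> R by rewrite dual_subr subr_eq0.
have su : {in s, forall q : dual Y, q u = 0 :> R}.
  by move=> q qs; rewrite dual_subr -LE// subrr.
have [q qE] := finite_rank_dual L p.
exists (((p u : R)^-1 *: (p - q), u) :: L) => v r.
have frE : finite_rank (((p u : R)^-1 *: (p - q), u) :: L) v =
    ((p u : R)^-1 * (p v - q v)) *: u + finite_rank L v.
  by rewrite /finite_rank big_cons.
rewrite frE dual_addr dual_scaler inE => /predU1P[->|rs].
  by rewrite mulrAC mulVf// mul1r qE subrK.
by rewrite (su r rs) mulr0 add0r -(LE v r rs).
Qed.

Lemma infinite_dimensional_kernel s : infinite_dimensional Y ->
  exists2 x : Y, `|x| = 1 & {in s, forall p : dual Y, p x = 0 :> R}.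
Proof.
move=> infY; have [L LE] := common_kernel_finite_rank s.
have [h|] := pselect (forall v, v = finite_rank L v).
  exfalso; apply: infY; exists (size L), (fun i => (tnth (in_tuple L) i).2) => v.
  exists (fun i => (tnth (in_tuple L) i).1 v).
  by rewrite {1}(h v) /finite_rank big_tnth.
move=> /existsNP[w /eqP wL].
pose u := w - finite_rank L w.
have u0 : u != 0 by rewrite subr_eq0.
have nu0 : `|u| != 0 by rewrite normr_eq0.
exists (`|u|^-1 *: u); first by rewrite normrZ normfV normr_id mulVf.
by move=> p ps; rewrite dual_scaler dual_subr -LE// subrr mulr0.
Qed.

(** A finite-dimensional normed space has continuous coordinates. *)
Lemma finite_dimensional_finite_rank : ~ infinite_dimensional Y ->
  exists L, forall v, v = finite_rank L v.
Proof.
move=> /contrapT[n [b bY]].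
pose b' (k : nat) : Y := oapp b 0 (insub k).
suff [s sE] : exists s, forall v (c : nat -> R), v = \sum_(i < n) c i *: b' i ->
    {in s, forall p : dual Y, p v = 0 :> R} -> v = 0.
  have [L LE] := common_kernel_finite_rank s.
  exists L => v; apply/eqP; rewrite -subr_eq0; apply/eqP.
  have [c cE] := bY (v - finite_rank L v).
  apply: (sE _ (fun k => oapp c 0 (insub k))).
    rewrite [LHS]cE; apply: eq_bigr => i _; rewrite /b'.
    by rewrite insubT//= => ilt; rewrite (_ : Sub _ _ = i)//; exact: val_inj.
  by move=> p ps; rewrite dual_subr -LE// subrr.
clearbody b'; clear b bY; elim: n b' => [|n IH] b; first by exists [::] => v c; rewrite big_ord0.
have [s sE] := IH b.
have [h|] := pselect (exists v (c : nat -> R), v = \sum_(i < n.+1) c i *: b i /\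
    {in s, forall p : dual Y, p v = 0 :> R} /\ v != 0); last first.
  move=> h; exists s => v c vE vs; apply/eqP; apply: contra_notT h => v0.
  by exists v, c.
case: h => v [c [vE [vs v0]]].
(* the functionals in [s] have an at most one-dimensional common kernel on the span of
   the first n + 1 vectors; norming one kernel vector [v] kills it *)
have [q _ qv] := norming_functional v.
have cn0 : c n != 0.
  apply: contraNneq v0 => cn0; apply/eqP; apply: (sE _ c) => //.
  by rewrite vE big_ord_recr/= cn0 scale0r addr0.
exists (q :: s) => w d wE ws.
have ws' : {in s, forall p : dual Y, p w = 0 :> R}.
  by move=> p ps; apply: ws; rewrite inE ps orbT.
have : w - (d n / c n) *: v = 0.
  apply: (sE _ (fun k => d k - (d n / c n) * c k)).
    rewrite wE vE !big_ord_recr/= scalerDr scalerA divfK// opprD addrACA subrr addr0.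
    rewrite scaler_sumr -sumrB; apply: eq_bigr => i _.
    by rewrite scalerBl scalerA.
  by move=> p ps; rewrite dual_subr dual_scaler vs// ws'// mulr0 subrr.
move=> /eqP; rewrite subr_eq0 => /eqP wv.
have : q w = 0 :> R by apply: ws; rewrite inE eqxx.
rewrite wv dual_scaler qv => /eqP; rewrite mulf_eq0 normr_eq0 (negbTE v0) orbF.
by move=> /eqP ->; rewrite scale0r.
Qed.

(** As in Riesz's lemma, the unit ball of the dual contains a 1-separated sequence:
f n norms a unit vector killed by the previous functionals. *)
Lemma dual_separated_sequence : infinite_dimensional Y ->
  exists f : nat -> dual Y, (forall n, `|f n| <= 1) /\
    forall m n, m != n -> 1 <= `|f m - f n|.
Proof.
move=> infY.
have ex s : {p : dual Y | `|p| <= 1 /\ {in s, forall q, 1 <= `|p - q|}}.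
  apply: cid; have [x x1 xs] := infinite_dimensional_kernel s infY.
  have [p p1 px] := norming_functional x.
  exists p; split=> // q qs; rewrite -x1 -px.
  have := @ler_dual_unit _ _ (p - q) x; rewrite dualBE (xs q qs) subr0 x1 px normr_id.
  by move=> ->.
pose g := fix g n := if n is m.+1 then sval (ex (g m)) :: g m else [::].
exists (fun n => sval (ex (g n))); split=> [n|]; first by have [] := svalP (ex (g n)).
have lt m n : (m < n)%N -> 1 <= `|sval (ex (g n)) - sval (ex (g m))|.
  move=> mn; have [_] := svalP (ex (g n)); apply.
  elim: n mn => // n IH; rewrite ltnS leq_eqVlt => /predU1P[->|/IH h].
    by rewrite inE eqxx.
  by rewrite inE h orbT.
move=> m n; case: ltngtP => // [mn|nm] _; last exact: lt.
by rewrite distrC lt.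
Qed.

End FiniteDimension.

(** * Gateaux and Frechet derivatives *)

Section Differentiability.
Context (R : realType) (Y : normedModType R).
Implicit Types (f : Y -> R^o) (x v : Y).

Lemma is_deriveP f x v (d : R) : is_derive x v f d <->
  forall e, 0 < e -> exists2 del, 0 < del &
    forall t : R, t != 0 -> `|t| < del -> `|f (t *: v + x) - f x - t * d| <= e * `|t|.
Proof.
have -> : is_derive x v f d <->
    ((fun h => h^-1 *: ((f \o shift x) (h *: v) - f x)) @ (0 : R)^' --> (d : R^o)).
  split=> [[df <-]//|df].
  by split; [exact: cvgP df|exact: cvg_lim].
have key t : t != 0 ->
    `|d - t^-1 *: ((f \o shift x) (t *: v) - f x)| * `|t| =
    `|f (t *: v + x) - f x - t * d|.
  move=> t0; rewrite -normrM -normrN; congr (`|_|).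
  by rewrite -[_ *: _]/(t^-1 * _) /=; field.
split=> [/cvgrPdist_le fd e e0|h].
  have := fd e e0; rewrite near_withinE => /nbhs_normP[del /= del0 H].
  exists del => // t t0 tdel; rewrite -key// ler_wpM2r//.
  by apply: H => //=; rewrite sub0r normrN.
apply/cvgrPdist_le => e e0; rewrite near_withinE; apply/nbhs_normP.
have [del del0 H] := h e e0; exists del => //= t; rewrite /ball_/= ?sub0r normrN => tdel t0.
by rewrite -(ler_pM2r (_ : 0 < `|t|)) ?normr_gt0// key// H.
Qed.

Lemma differentiable_dual f x (q : dual Y) :
  (forall e, 0 < e -> exists2 del, 0 < del &
    forall h, `|h| < del -> `|f (h + x) - f x - q h| <= e * `|h|) ->
  differentiable f x.
Proof.
move=> H.
have fq : f \o shift x = cst (f x) + (q : Y -> R^o) +o_ (0 : Y) id.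
  apply/eqaddoP => e e0; have [del del0 Hdel] := H e e0.
  apply/nbhs_normP; exists del => //= h.
  rewrite /ball_/= sub0r normrN => hdel.
  by rewrite -[X in `|X|]/(f (h + x) - (f x + q h)) opprD addrA; exact: Hdel.
have cq : continuous (q : Y -> R^o) by exact: dual_continuous.
have dq := diff_unique cq fq.
by apply/diff_locallyP; rewrite dq.
Qed.

Lemma differentiable_derivE f x (p : dual Y) : differentiable f x ->
  (forall v, is_derive x v f (p v)) ->
  forall e, 0 < e -> exists2 del, 0 < del &
    forall h, `|h| < del -> `|f (h + x) - f x - p h| <= e * `|h|.
Proof.
move=> df fp e e0.
have dp : ('d f x : Y -> R^o) = p.
  by apply/funext => v; rewrite -deriveE//; have [_ ->] := fp v.
have /diff_locallyP[_] := df; rewrite dp => /eqaddoP/(_ e e0)/nbhs_normP[del /= del0 H].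
exists del => // h hdel.
have := H h; rewrite /ball_/= sub0r normrN => /(_ hdel).
by rewrite -[X in `|X|]/(f (h + x) - (f x + p h)) opprD addrA.
Qed.

Lemma convex_functionP f : convex_function [set: convex_lmodType Y] f <->
  forall (t : R) x y, 0 <= t -> t <= 1 ->
    f (t *: x + (1 - t) *: y) <= t * f x + (1 - t) * f y.
Proof.
split=> [cf t x y t0 t1|cf t x y _ _].
  have t01 : 0 <= t <= 1 by rewrite t0.
  pose T : {i01 R} := Itv01 t0 t1.
  by have := cf T x y (mem_setT _) (mem_setT _).
exact: cf.
Qed.

End Differentiability.

(** * Convex functions that are Gateaux but not Frechet differentiable *)

Lemma abs_ge0 (R : realType) (a : R) : 0 <= `|a|. Proof. exact: normr_ge0. Qed.
Lemma abs_leD (R : realType) (a b : R) : `|a + b| <= `|a| + `|b|.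
Proof. exact: ler_normD. Qed.

Section PGNFFunctions.
Context (R : realType) (Y : normedModType R).
Implicit Types (f : Y -> R^o) (x v : Y).

(** In finite dimension Gateaux derivatives of convex functions are Frechet
derivatives: the excess of f over its derivative is convex, hence controlled by
its values along finitely many coordinate lines. *)
Lemma convex_Gateaux_Frechet f x : ~ infinite_dimensional Y ->
  convex_function [set: convex_lmodType Y] f ->
  Gateaux_differentiable f x -> differentiable f x.
Proof.
move=> /finite_dimensional_finite_rank[L LE] /convex_functionP cf [p fp].
pose g v := f (v + x) - f x - (p v : R).
have g0 : g 0 = 0 by rewrite /g add0r subrr linear0 subr0.
have gmid u v : g ((1 / 2) *: u + (1 / 2) *: v) <= (g u + g v) / 2.
  have := cf (1 / 2) (u + x) (v + x).
  rewrite (_ : 1 - 1 / 2 = 1 / 2 :> R); last by field.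
  rewrite !scalerDr addrACA -scalerDl (_ : 1 / 2 + 1 / 2 = 1 :> R); last by field.
  by rewrite scale1r /g dual_addr !dual_scaler => h; have := h ltac:(lra) ltac:(lra); lra.
have gline b e : 0 < e -> exists2 del, 0 < del &
    forall t : R, `|t| < del -> g (t *: b) <= e * `|t|.
  move=> e0; have /is_deriveP/(_ e e0)[del del0 H] := fp b.
  exists del => // t tdel; have [->|t0] := eqVneq t 0.
    by rewrite scale0r g0 normr0 mulr0.
  by apply: le_trans (ler_norm _) _; rewrite /g dual_scaler; exact: H.
(* split off one coordinate at a time as the midpoint of two doubled vectors *)
have gL : forall e, 0 < e -> exists2 del, 0 < del &
    forall h, `|h| < del -> g (finite_rank L h) <= e * `|h|.
  elim: (L) => [|c K IH] e e0.
    by exists 1 => // h _; rewrite /finite_rank big_nil g0 mulr_ge0// ltW.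
  have c0 : 0 < `|c.1| + 1 by rewrite ltr_wpDl.
  have e1 : 0 < e / 2 / (`|c.1| + 1) by rewrite !divr_gt0.
  have [d1 d10 H1] := gline c.2 _ e1.
  have e2 : 0 < e / 2 by rewrite divr_gt0.
  have [d2 d20 H2] := IH _ e2.
  exists (Num.min (d1 / (2 * (`|c.1| + 1))) (d2 / 2)).
    by rewrite lt_min !divr_gt0// mulr_gt0.
  move=> h; rewrite lt_min => /andP[h1 h2].
  have -> : finite_rank (c :: K) h = (1 / 2) *: ((2 * (c.1 h : R)) *: c.2) +
     (1 / 2) *: finite_rank K (2 *: h).
    rewrite /finite_rank big_cons scalerA mulrA div1r mulVf// mul1r; congr (_ + _).
    rewrite scaler_sumr; apply: eq_bigr => d _.
    by rewrite dual_scaler scalerA mulrA mulVf// mul1r.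
  apply: (le_trans (gmid _ _)).
  have ch : `|c.1 h : R| <= (`|c.1| + 1) * `|h|.
    by rewrite (le_trans (ler_dual _ _))// ler_wpM2r// lerDl.
  have n2 : `|2 * (c.1 h : R)| = 2 * `|c.1 h : R| by rewrite normrM ger0_norm.
  have t1 : `|2 * (c.1 h : R)| < d1.
    rewrite n2; move: h1; rewrite ltr_pdivlMr ?mulr_gt0// => h1.
    apply: le_lt_trans h1; rewrite mulrC.
    by have := ch; rewrite -(ler_pM2l (_ : 0 < 2 :> R))//; lra.
  have t2 : `|2 *: h| < d2.
    by rewrite normrZ ger0_norm//; move: h2; rewrite ltr_pdivlMr// mulrC.
  have := H1 _ t1; have := H2 _ t2.
  rewrite n2 normrZ ger0_norm// => r2 r1.
  have r1' : e / 2 / (`|c.1| + 1) * (2 * `|c.1 h : R|) <= e * `|h|.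
    have -> : e / 2 / (`|c.1| + 1) * (2 * `|c.1 h : R|) =
        e / (`|c.1| + 1) * `|c.1 h : R| by field; rewrite gt_eqF.
    by rewrite mulrAC ler_pdivrMr// -mulrA ler_pM2l// mulrC.
  lra.
apply: (@differentiable_dual _ _ _ _ p) => e e0.
have [del del0 H] := gL e e0; exists del => // h hdel.
have gh u : `|u| < del -> g u <= e * `|u| by move=> /H; rewrite -LE.
rewrite -/(g h) ler_norml; apply/andP; split; last exact: gh.
have := gh (- h); rewrite normrN => /(_ hdel).
have := gmid h (- h); rewrite -scalerDr subrr scaler0 g0; lra.
Qed.

(** The supremum of the |q_n| - 1/(n+1) is a convex 1-Lipschitz function with
zero Gateaux derivative at 0, since q_n tends to 0 pointwise; this is not a
Frechet derivative since |q_n| = 1. *)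
Lemma normalized_null_PGNF (q : nat -> dual Y) :
  (forall n, `|q n| = 1) -> (forall x, (q n x : R) @[n --> \oo] --> (0 : R)) ->
  exists f : Y -> R^o, [/\ convex_function [set: convex_lmodType Y] f,
    continuous f & PGNF f].
Proof.
move=> q1 q0.
have [c cE] : exists c : nat -> R, forall n, c n = n.+1%:R^-1 by exists (fun n => n.+1%:R^-1).
have c_gt0 n : 0 < c n by rewrite cE invr_gt0.
pose F n x : R := `|q n x : R| - c n.
pose f x : R := sup [set F n x | n in [set: nat]].
have qx n x : `|q n x : R| <= `|x| by rewrite (le_trans (ler_dual _ _))// q1 mul1r.
have Fub x : has_ubound [set F n x | n in [set: nat]].
  exists `|x| => _ [n _ <-]; rewrite /F.
  by rewrite (le_trans _ (qx n x))// gerBl ltW.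
have leF n x : F n x <= f x by apply: ub_le_sup => //; exists n.
have fle x M : (forall n, F n x <= M) -> f x <= M.
  by move=> h; apply: ge_sup => [|_ [n _ <-]//]; exists (F 0%N x), 0%N.
have inv_small (e : R) : 0 < e -> exists N : nat, forall n, (N <= n)%N -> c n < e.
  move=> e0; have [N _ H] := near_infty_natSinv_lt (PosNum e0).
  by exists N => n Nn; rewrite cE; exact: H.
have fge0 x : 0 <= f x.
  apply/ler_addgt0Pr => e /inv_small[N /(_ N (leqnn N)) h].
  have := leF N x; rewrite /F; have := abs_ge0 (q N x); lra.
have f0 : f 0 = 0.
  apply/eqP; rewrite eq_le fge0 andbT; apply: fle => n.
  by rewrite /F linear0 normr0 sub0r oppr_le0 ltW.
have flip x y : f x <= f y + `|x - y|.
  apply: fle => n; have := leF n y; rewrite /F.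
  have := qx n (x - y); rewrite dual_subr.
  by have := abs_leD (q n x - q n y : R) (q n y); rewrite subrK; lra.
exists f; split.
- apply/convex_functionP => t x y t0 t1; apply: fle => n; rewrite /F.
  rewrite dual_addr !dual_scaler.
  have t1' : 0 <= 1 - t by lra.
  have := ler_wpM2l t0 (leF n x); have := ler_wpM2l t1' (leF n y); rewrite /F.
  have := abs_leD (t * (q n x : R)) ((1 - t) * (q n y : R)).
  by rewrite !normrM (ger0_norm t0) (ger0_norm t1'); lra.
- move=> x; apply/(@cvgrPdist_lt R R^o) => e e0; near=> y.
  have xy : `|x - y| < e by near: y; exact: cvgr_dist_lt.
  apply: le_lt_trans xy; have := flip x y; have := flip y x.
  by rewrite (distrC y x) => h1 h2; rewrite ler_norml; apply/andP; split; lra.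
have G0 v : is_derive (0 : Y) v (f : Y -> R^o) ((0 : dual Y) v).
  apply/is_deriveP => e e0.
  have /cvgrPdist_le/(_ e e0)[N _ HN] := q0 v.
  have v1 : 0 < `|v| + 1 by rewrite ltr_wpDl.
  exists (c N / (`|v| + 1)); first by rewrite divr_gt0.
  move=> t _; rewrite ltr_pdivlMr// => tN.
  rewrite dual0E mulr0 subr0 f0 subr0 addr0 ger0_norm//; apply: fle => n.
  rewrite /F dual_scaler normrM.
  have [Nn|nN] := leqP N n.
    have := HN n Nn; rewrite sub0r normrN => h.
    rewrite mulrC; have := ler_wpM2r (normr_ge0 t) h.
    by have := c_gt0 n; lra.
  have h1 : c N <= c n by rewrite !cE lef_pV2 ?posrE// ler_nat ltnS ltnW.
  have h2 : 0 <= e * `|t| by rewrite mulr_ge0// ltW.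
  have := ler_wpM2l (normr_ge0 t) (qx n v).
  have := normr_ge0 t; nra.
exists 0; split; first by exists 0.
move=> df; have e0 : 0 < 8^-1 :> R by [].
have [del del0 H] := differentiable_derivE df G0 e0.
have d4 : 0 < del / 4 by rewrite divr_gt0.
have [n /(_ n (leqnn n)) ndel] := inv_small _ d4.
have [x x1 qnx] : exists2 x, `|x| <= 1 & 2^-1 < `|q n x : R|.
  by apply: dual_norm_ltP; rewrite q1; lra.
have n0 := c_gt0 n.
have t0 : 0 <= 4 * c n :> R by lra.
(* at the point (4 / (n+1)) x the n-th term alone is at least 1 / (n+1) *)
have nz : `|(4 * c n) *: x| <= 4 * c n by rewrite normrZ ger0_norm// ler_piMr.
have lt4 : 4 * c n < del by lra.
have := H _ (le_lt_trans nz lt4).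
rewrite addr0 f0 !subr0 (ger0_norm (fge0 _)).
have := leF n ((4 * c n) *: x); rewrite /F dual_scaler normrM (ger0_norm t0).
move: (f _) nz => fx; nra.
Unshelve. all: by end_near. Qed.

End PGNFFunctions.

(** * Refinements of sequences, and limits along ultrafilters *)

Section Refinement.
Context (A : Type) (Q : set A) (cl : set A -> set A).
Hypothesis cl_sub : forall S, S `<=` cl S.
Hypothesis cl_mono : forall S T, S `<=` T -> cl S `<=` cl T.
Hypothesis cl_idem : forall S, cl (cl S) `<=` cl S.
Implicit Types (u v w : nat -> A).

(** The set of the terms of index at least N. *)
Definition tail_set u N : set A := [set u n | n in [set n | (N <= n)%N]].

(** With respect to a closure operator cl, v refines u when it is eventually in the
closure of each tail of u; all terms of v must moreover satisfy Q.  For cl = id this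
is the notion of subsequence, up to repetitions, reordering and finitely many terms. *)
Definition refines v u : Prop := (forall m, Q (v m)) /\
  forall N, exists M, forall m, (M <= m)%N -> cl (tail_set u N) (v m).

Lemma refines_refl u : (forall n, Q (u n)) -> refines u u.
Proof.
by move=> Qu; split=> // N; exists N => m Nm; apply: cl_sub; exists m.
Qed.

Lemma refines_trans v u w : refines v u -> refines w v -> refines w u.
Proof.
move=> [_ vu] [Qw wv]; split=> // N; have [M vuM] := vu N.
have [M' wvM'] := wv M; exists M' => m /wvM' h.
apply: cl_idem; apply: cl_mono h => _ [n /= Mn <-]; exact: vuM.
Qed.

Lemma refines_pick v u : (forall m, Q (v m)) ->
  (forall m, exists2 k, (m <= k)%N & v m = u k) -> refines v u.
Proof.
move=> Qv vu; split=> // N; exists N => m Nm; apply: cl_sub.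
by have [k mk ->] := vu m; exists k => //=; exact: leq_trans mk.
Qed.

(** The diagonal argument: a descending sequence has a lower bound. *)
Lemma refines_diagonal (u : nat -> nat -> A) : (forall m, Q (u 0%N m)) ->
  (forall k, refines (u k.+1) (u k)) -> exists w, forall k, refines w (u k).
Proof.
move=> Q0 uS.
have Qu k m : Q (u k m) by case: k => [|k]; [exact: Q0|have [] := uS k].
have ule j k : (j <= k)%N -> refines (u k) (u j).
  move=> jk; rewrite -(subnKC jk); elim: (k - j)%N => [|i IH].
    by rewrite addn0; apply: refines_refl.
  by rewrite addnS; apply: refines_trans IH _.
have ex k : exists m, forall j, (j <= k)%N -> cl (tail_set (u j) k) (u k m).
  suff [M HM] : exists M, forall m, (M <= m)%N -> forall j, (j <= k)%N ->
      cl (tail_set (u j) k) (u k m) by exists M; exact: HM.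
  have : forall i, (i <= k)%N -> exists M, forall m, (M <= m)%N -> forall j, (j <= i)%N ->
      cl (tail_set (u j) k) (u k m).
    elim=> [_|i IH ik].
      have [_ /(_ k)[M HM]] := ule 0%N k (leq0n k).
      by exists M => m Mm j; rewrite leqn0 => /eqP ->; exact: HM.
    have [M HM] := IH (ltnW ik).
    have [_ /(_ k)[M' HM']] := ule i.+1 k ik.
    exists (maxn M M') => m; rewrite geq_max => /andP[Mm M'm] j.
    by rewrite leq_eqVlt ltnS => /predU1P[->|ji]; [exact: HM'|exact: HM].
  by move=> /(_ k (leqnn k)).
have [m mE] := choice ex.
exists (fun k => u k (m k)) => j; split=> // N.
exists (maxn j N) => k; rewrite geq_max => /andP[jk Nk].
apply: cl_mono (mE k j jk) => _ [n /= kn <-]; exists n => //=.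
exact: leq_trans kn.
Qed.

(** Countably many hereditary dense properties hold simultaneously below u. *)
Lemma refines_all (P : nat -> (nat -> A) -> Prop) u :
  (forall n, Q (u n)) ->
  (forall k v w, refines w v -> P k v -> P k w) ->
  (forall k v, refines v u -> exists2 w, refines w v & P k w) ->
  exists2 v, refines v u & forall k, P k v.
Proof.
move=> Qu Pher Pdense.
have ex k (v : {v | refines v u}) : {w : {w | refines w u} |
    refines (sval w) (sval v) /\ P k (sval w)}.
  apply: cid; have [w wv Pw] := Pdense k _ (svalP v).
  by exists (exist (fun w => refines w u) w (refines_trans (svalP v) wv)).
pose g := fix g k : {v | refines v u} :=
  if k is k'.+1 then sval (ex k' (g k')) else exist (fun w => refines w u) u (refines_refl Qu).
have gS k : refines (sval (g k.+1)) (sval (g k)).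
  by have [] := svalP (ex k (g k)).
have [w wE] := @refines_diagonal (fun k => sval (g k)) Qu gS.
exists w => [|k]; first exact: wE 0%N.
by apply: Pher (wE k.+1) _; have [] := svalP (ex k (g k)).
Qed.

(** A monotone bounded quantity is constant below some refinement. *)
Lemma refines_stable (R : realType) (d : (nat -> A) -> R) u :
  (forall n, Q (u n)) ->
  (forall v w, refines v u -> refines w v -> 0 <= d w <= d v) ->
  exists2 v, refines v u & forall w, refines w v -> d w = d v.
Proof.
move=> Qu dle.
have [|k v vu|v vu vP] := @refines_all
  (fun k v => refines v u /\ forall w, refines w v -> d v <= d w + k.+1%:R^-1) u Qu.
- move=> k v w wv [vu h]; split; first exact: refines_trans wv.
  move=> w' w'w; have w'v := refines_trans wv w'w.
  apply: le_trans (h _ w'v).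
  by have /andP[] := dle _ _ vu wv.
- pose E := [set d w | w in [set w | refines w v]].
  have Qv : forall n, Q (v n) by have [] := vu.
  have hE : has_inf E.
    split; first by exists (d v), v => //; exact: refines_refl.
    by exists 0 => _ [w wv <-]; have /andP[] := dle _ _ vu wv.
  have k0 : 0 < k.+1%:R^-1 :> R by rewrite invr_gt0.
  have [_ [w wv <-] wlt] := inf_adherent k0 hE.
  exists w => //; split; first exact: refines_trans wv.
  move=> w' w'w; apply: (le_trans (ltW wlt)); rewrite lerD2r.
  by apply: ge_inf; [exact: hE.2|exists w' => //; exact: refines_trans w'w].
exists v => // w wv; apply/eqP; rewrite eq_le; have /andP[_ ->] := dle _ _ vu wv.
apply/ler_addgt0Pr => e e0.
have [N _ H] := near_infty_natSinv_lt (PosNum e0).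
apply: le_trans ((vP N).2 _ wv) _; rewrite lerD2l ltW//; exact: (H N (leqnn N)).
Qed.

End Refinement.

Section Limits.
Context (R : realType).

Lemma ultra_bounded_cvg (T : Type) (F : set_system T) (f : T -> R) (C : R) :
  UltraFilter F -> (\forall t \near F, `|f t| <= C) ->
  exists l : R, f @ F --> l.
Proof.
move=> FU fC.
have [|l [_ lF]] := @segment_compact R (- C) C (f @ F).
  by near=> t; rewrite /= in_itv/= -ler_norml; near: t.
exists l; apply/cvgrPdist_lt => e e0.
have [//|nF] := in_ultra_setVsetC [set t | `|l - f t| < e] FU.
have [||y [/= h1 h2]] := lF (~` ball l e) (ball l e).
- apply: filterS nF => t h; rewrite -ball_normE; exact: h.
- exact: nbhsx_ballx.
by [].
Unshelve. all: by end_near. Qed.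

Lemma ultra_eventually : exists U : set_system nat,
  UltraFilter U /\ (\oo : set_system nat) `<=` U.
Proof. exact: ultraFilterLemma. Qed.

Lemma real_cvg_unique (T : Type) (F : set_system T) {FF : ProperFilter F}
    (f : T -> R) (a b : R) : f @ F --> a -> f @ F --> b -> a = b.
Proof. apply: (@cvg_unique _ (@Rhausdorff R)). Qed.

Lemma real_cvg_le (T : Type) (F : set_system T) {FF : ProperFilter F}
    (f : T -> R) (a M : R) :
  f @ F --> a -> (\forall t \near F, f t <= M) -> a <= M.
Proof.
by move=> fa fM;
  exact: (@closed_cvg T R F FF f [set x : R | x <= M] (@closed_le R M) fM a fa).
Qed.

Lemma real_cvg_sum (T : Type) (F : set_system T) {FF : Filter F}
    (f : nat -> T -> R) (l : nat -> R) n : (forall i, f i @ F --> l i) ->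
  (\sum_(i < n) f i t) @[t --> F] --> \sum_(i < n) l i.
Proof.
move=> fl; elim: n => [|n IH].
  by rewrite big_ord0; under eq_fun do rewrite big_ord0; exact: cvg_cst.
rewrite big_ord_recr; under eq_fun do rewrite big_ord_recr.
by apply: cvgD => //; exact: fl.
Qed.

Context (Y : normedModType R).

(** A pointwise limit of bounded functionals is a bounded functional. *)
Lemma pointwise_limit_dual (T : Type) (F : set_system T) (P : T -> dual Y) (C : R) :
  ProperFilter F -> 0 <= C -> (\forall t \near F, `|P t| <= C) ->
  (forall x, exists l : R, (P t x : R) @[t --> F] --> l) ->
  exists2 q : dual Y, `|q| <= C & forall x, (P t x : R) @[t --> F] --> (q x : R).
Proof.
move=> FF C0 PC /choice[f fE].
have [x y|a x|x|q qE qC] := @bounded_form_dual R Y f C C0.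
- apply: (real_cvg_unique (fE (x + y))).
  have -> : (fun t => P t (x + y) : R) = (fun t => P t x + P t y).
    by apply/funext => t; rewrite dual_addr.
  by apply: cvgD; exact: fE.
- apply: (real_cvg_unique (fE (a *: x))).
  have -> : (fun t => P t (a *: x) : R) = (fun t => a * P t x).
    by apply/funext => t; rewrite dual_scaler.
  by apply: cvgM; [exact: cvg_cst|exact: fE].
- apply: (real_cvg_le (cvg_norm (fE x))); near=> t.
  by apply: (le_trans (ler_dual _ _)); rewrite ler_wpM2r//; near: t.
by exists q => // x; rewrite qE.
Unshelve. all: by end_near. Qed.

End Limits.

(** * Rosenthal's dichotomy *)

Lemma infinite_pigeonhole (I : finType) (P : nat -> I -> Prop) (M : nat) :
  (forall m, (M <= m)%N -> exists i, P m i) ->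
  exists i, forall n, exists2 m, (n <= m)%N & P m i.
Proof.
move=> PM; apply: contrapT => h.
have {}h i : exists n, forall m, (n <= m)%N -> ~ P m i.
  apply: contrapT => hi; apply: h; exists i => n.
  apply: contrapT => hn; apply: hi; exists n => m nm Pmi; apply: hn.
  by exists m.
have [n nE] := choice h.
have [|i] := PM (maxn M (\max_i n i)); first exact: leq_maxl.
by apply: nE; rewrite (leq_trans (leq_bigmax i))// leq_maxr.
Qed.

Section Rosenthal.
Context (R : realType) (A S : Type) (ev : A -> S -> R) (Q : set A).
Implicit Types (u v w : nat -> A) (x : S).

Let refines := @refines A Q id.

Let refines_refl' u : (forall n, Q (u n)) -> refines u u.
Proof. by move=> Qu; apply: (@refines_refl A Q id (fun _ _ h => h)). Qed.

Let refines_trans' v u w : refines v u -> refines w v -> refines w u.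
Proof. by move=> vu wv; apply: (@refines_trans A Q id _ _ v u w vu wv) => // X Y; apply. Qed.

Let refines_all' := @refines_all A Q id
  (fun _ _ h => h) (fun _ _ h => h) (fun _ _ h => h).

(** P holds for infinitely many terms of u. *)
Definition frequently (P : A -> Prop) u := forall N : nat, exists2 n, (N <= n)%N & P (u n).

Lemma frequently_refines P u v : refines v u -> frequently P v -> frequently P u.
Proof.
move=> [_ vu] Pv N; have [M vM] := vu N.
have [n Mn Pn] := Pv M; have [k /= Nk kn] := vM n Mn.
by exists k => //; rewrite kn.
Qed.

(** No point of X sees u oscillate across the gap between r and s. *)
Definition no_oscillation (r s : R) u (X : set S) := forall x, X x ->
  ~ (frequently (fun a => ev a x <= r) u /\ frequently (fun a => s <= ev a x) u).

Lemma no_oscillation_refines r s u v X : refines v u ->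
  no_oscillation r s u X -> no_oscillation r s v X.
Proof.
by move=> vu uX x Xx [h1 h2]; apply: (uX x Xx); split; apply: frequently_refines vu _.
Qed.

(** The set where a is at least s, or the one where it is at most r. *)
Definition side (r s : R) (b : bool) (a : A) : set S :=
  if b then [set x | s <= ev a x] else [set x | ev a x <= r].

(** Every refinement of u oscillates on each X l, for l of length N. *)
Definition oscillating (r s : R) (N : nat) (X : seq bool -> set S) u :=
  forall v, refines v u -> forall l : seq bool, size l = N -> ~ no_oscillation r s v (X l).

(** Each X w is cut into two by a; the first letter of a word is the newest one. *)
Definition split_family (r s : R) (X : seq bool -> set S) (a : A) (w : seq bool) : set S :=
  if w is b :: w' then X w' `&` side r s b a else set0.

(** Rosenthal's lemma: for some term a of u, the cut family still oscillates along some
refinement. *)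
Lemma oscillating_split r s N X u : (forall n, Q (u n)) -> oscillating r s N X u ->
  exists a, Q a /\
    exists2 v, refines v u & oscillating r s N.+1 (split_family r s X a) v.
Proof.
move=> Qu uX; apply: contrapT => h.
pose P k v := exists2 l : seq bool, size l = N.+1 &
    no_oscillation r s v (split_family r s X (u k) l).
have [k v w wv [l lN h']|k v vu|v vu vP] := refines_all' (P := P) Qu.
- by exists l => //; apply: no_oscillation_refines h'.
- apply: contrapT => hv; apply: h; exists (u k); split; first exact: Qu.
  exists v => // w wv l lN wl; apply: hv; exists w => //.
  by exists l.
(* otherwise some refinement [v] stops oscillating on a part of some [X l], for each
   of the cuts by its own terms; the same part [w] serves for infinitely many terms,
   which contradicts the oscillation of these terms on [X l] *)
have [M vM] := vu.2 0%N.
pose P' m (w : N.+1.-tuple bool) := no_oscillation r s v (split_family r s X (v m) w).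
have [m Mm|w wP] := @infinite_pigeonhole _ P' M.
  have [k _ kv] := vM m Mm; have [l lN lv] := vP k.
  have lN' : size l == N.+1 by apply/eqP.
  by exists (Tuple lN'); rewrite /P' -kv.
have [m mn mP] : exists2 m : nat -> nat, (forall n, (n <= m n)%N) & forall n, P' (m n) w.
  have /choice[m mE] : forall n, exists m, (n <= m)%N /\ P' m w.
    by move=> n; have [m] := wP n; exists m.
  by exists m => n; have [] := mE n.
pose v' n := v (m n).
have v'v : refines v' v 
  by apply: (@refines_pick A Q id (fun _ _ h => h)) => [k|n]; [exact: vu.1|exists (m n)].
have [b [l wE]] : exists b l, tval w = b :: l.
  by case: w {wP mP} => -[|b l]//= _; exists b, l.
have lN : size l = N by have := size_tuple w; rewrite wE => -[].
have := uX v' (refines_trans' vu v'v) l lN; apply.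
have key k x : X l x -> side r s b (v (m k)) x ->
    ~ (frequently (fun a => ev a x <= r) v' /\ frequently (fun a => s <= ev a x) v').
  move=> Xx hx [h1 h2].
  have := mP k; rewrite /P' wE => /(_ x (conj Xx hx)); apply.
  by split; [exact: frequently_refines v'v h1|exact: frequently_refines v'v h2].
move=> x Xx osc; case: (osc) => h1 h2.
case: b wE key => wE key.
  by have [k _ hk] := h2 0%N; exact: (key k x Xx hk osc).
by have [k _ hk] := h1 0%N; exact: (key k x Xx hk osc).
Qed.

(** Boolean independence: all finite patterns of sides are realized in B. *)
Lemma oscillating_independent r s u (B : set S) : (forall n, Q (u n)) ->
  oscillating r s 0 (fun=> B) u ->
  exists2 a : nat -> A, (forall k, Q (a k)) &
    forall (c : nat -> bool) N, exists2 x, B x & forall k, (k < N)%N -> side r s (c k) (a k) x.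
Proof.
move=> Qu uB.
pose st := (nat * (seq bool -> set S) * (nat -> A))%type.
pose ok (t : st) := refines t.2 u /\ oscillating r s t.1.1 t.1.2 t.2.
pose next (t t' : st) a := t'.1.1 = t.1.1.+1 /\ t'.1.2 = split_family r s t.1.2 a.
have ex (t : {t | ok t}) : {t' : {t | ok t} * A |
    Q t'.2 /\ next (sval t) (sval t'.1) t'.2}.
  apply: cid; case: t => -[[N X] v] /= [vu vX].
  have [a [Qa [w wv wX]]] := oscillating_split vu.1 vX.
  by exists (exist ok (N.+1, split_family r s X a, w) (conj (refines_trans' vu wv) wX), a).
pose t0 : {t | ok t} := exist ok (0%N, fun=> B, u) (conj (refines_refl' Qu) uB).
pose g := fix g k := if k is k'.+1 then (sval (ex (g k'))).1 else t0.
pose a k := (sval (ex (g k))).2.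
have gN k : (sval (g k)).1.1 = k.
  by elim: k => //= k IH; have [_ [-> _]] := svalP (ex (g k)); rewrite IH.
have gX k : (sval (g k.+1)).1.2 = split_family r s (sval (g k)).1.2 (a k).
  by have [_ []] := svalP (ex (g k)).
exists a => [k|c]; first by have [] := svalP (ex (g k)).
pose wd := fix wd N : seq bool := if N is k.+1 then c k :: wd k else [::].
have swd N : size (wd N) = N by elim: N => //= N ->.
have wdX N x : (sval (g N)).1.2 (wd N) x ->
    B x /\ forall k, (k < N)%N -> side r s (c k) (a k) x.
  elim: N => [|N IH]; first by move=> Bx; split.
  rewrite gX /= => -[/IH[Bx h] hN]; split=> // k.
  by rewrite ltnS leq_eqVlt => /predU1P[->//|]; exact: h.
move=> N; have [gu gosc] := svalP (g N).
have := gosc _ (refines_refl' gu.1) (wd N); rewrite gN swd => /(_ erefl) hN.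
have [x Xx] : exists x, (sval (g N)).1.2 (wd N) x.
  by apply: contrapT => h; apply: hN => x Xx; exfalso; apply: h; exists x.
by have [Bx h] := wdX N x Xx; exists x.
Qed.

(** Either some refinement converges pointwise on B, or it oscillates, with all
its refinements, across a fixed gap. *)
Lemma convergent_or_oscillating u (B : set S) (C : R) : (forall n, Q (u n)) ->
  (forall a x, Q a -> B x -> `|ev a x| <= C) ->
  (exists2 v, refines v u & forall x, B x ->
     exists l : R, ev (v n) x @[n --> \oo] --> l) \/
  exists r s v, [/\ r < s, refines v u & oscillating r s 0 (fun=> B) v].
Proof.
move=> Qu evC.
pose P k v := if (unpickle k : option (rat * rat)) is Some (p, q) then
  (p < q)%R -> no_oscillation (ratr p) (ratr q) v B else True.
have [h|] := pselect (forall k v, refines v u -> exists2 w, refines w v & P k w); last first.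
  move=> /existsNP[k /existsNP[v /not_implyP[vu h]]]; right.
  move: h; rewrite /P; case: (unpickle k) => [[p q]|]; last first.
    by move=> h; exfalso; apply: h; exists v => //; apply: refines_refl'; exact: vu.1.
  have [rs|_] := boolP (p < q)%R; last first.
    by move=> h; exfalso; apply: h; exists v => //; apply: refines_refl'; exact: vu.1.
  move=> h; exists (ratr p), (ratr q), v; split => //; first by rewrite ltr_rat.
  by move=> w wv l _ lw; apply: h; exists w.
left; have [k v w wv|v vu vP] := refines_all' (P := P) Qu _ h.
  rewrite /P; case: (unpickle k) => [[p q] hv rs|//].
  exact: no_oscillation_refines (hv rs).
exists v => // x Bx.
(* no rational gap is crossed infinitely often, so an ultrafilter limit is a limit *)
have [U [UU Uoo]] := ultra_eventually.
have [|l lU] := @ultra_bounded_cvg R _ U (fun n => ev (v n) x) C UU.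
  by apply: Uoo; near=> n; exact: evC (vu.1 n) Bx.
exists l; apply: contrapT => /cvgrPdist_lt/existsNP[e /not_implyP[e0 he]].
have freqU (D : set nat) : U D -> forall N, exists2 n, (N <= n)%N & D n.
  move=> UD N; have : U (D `&` [set n | (N <= n)%N]).
    by apply: filterI => //; apply: Uoo; exists N.
  by move=> /filter_ex[n [? ?]]; exists n.
have near_l (d : R) : 0 < d -> forall N, exists2 n, (N <= n)%N & `|l - ev (v n) x| < d.
  by move=> d0; apply: freqU; move/cvgrPdist_lt: lU; exact.
have freq_far N : exists2 n, (N <= n)%N & e <= `|l - ev (v n) x|.
  apply: contrapT => hN; apply: he; exists N => // n /= Nn.
  by rewrite ltNge; apply/negP => en; apply: hN; exists n.
have no_osc (r s : R) : r < s -> ~ (frequently (fun a => ev a x <= r) v /\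
    frequently (fun a => s <= ev a x) v).
  move=> rs [h1 h2].
  have [r'] := rat_in_itvoo rs; rewrite in_itv/= => /andP[rr' r's].
  have [s'] := rat_in_itvoo r's; rewrite in_itv/= => /andP[r's' s's].
  have := vP (pickle (r', s')); rewrite /P pickleK -(ltr_rat R) r's' => /(_ isT x Bx).
  apply; split=> N.
    by have [n Nn hn] := h1 N; exists n => //; rewrite (le_trans hn)// ltW.
  by have [n Nn hn] := h2 N; exists n => //; rewrite (le_trans _ hn)// ltW.
have e2 : 0 < e / 2 by rewrite divr_gt0.
apply: (no_osc (l + e / 2) (l + e)); first lra.
split; last first.
  move=> N; apply: contrapT => hN.
  apply: (no_osc (l - e) (l - e / 2)); first lra.
  split=> M; last first.
    have [n Mn] := near_l _ e2 M; rewrite ltr_norml => /andP[h1 h2].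
    by exists n => //; lra.
  have [n] := freq_far (maxn M N); rewrite geq_max => /andP[Mn Nn] hn.
  exists n => //; rewrite leNgt; apply/negP => hlt; apply: hN; exists n => //.
  move: hn; have [le0|le0] := leP 0 (l - ev (v n) x).
    by rewrite ger0_norm//; lra.
  by rewrite ltr0_norm//; lra.
move=> N; have [n Nn] := near_l _ e2 N; rewrite ltr_norml => /andP[h1 h2].
by exists n => //; lra.
Unshelve. all: by end_near. Qed.

End Rosenthal.

(** * Normalized combinations of a sequence of functionals *)

Section CoefficientNorm.
Context (R : realType).
Implicit Types (u v g h : {poly R}).

(** The l1 norm of the coefficients; {poly R} plays the role of c00. *)
Definition l1norm u : R := \sum_(i < size u) `|u`_i|.

Lemma l1normE N u : (size u <= N)%N -> l1norm u = \sum_(i < N) `|u`_i|.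
Proof.
move=> uN; rewrite /l1norm -(subnKC uN) big_split_ord/=.
rewrite [X in _ = _ + X]big1 ?addr0// => i _.
by rewrite nth_default ?normr0// leq_addr.
Qed.

Lemma l1normN u : l1norm (- u) = l1norm u.
Proof. by rewrite /l1norm size_polyN; apply: eq_bigr => i _; rewrite coefN normrN. Qed.

Lemma l1normXn n : l1norm 'X^n = 1.
Proof.
rewrite /l1norm size_polyXn big_ord_recr/= coefXn eqxx normr1 big1 ?add0r// => i _.
by rewrite coefXn lt_eqF ?normr0// ltEnat/=.
Qed.

Definition midpoint (V : lmodType R) (g h : V) : V := 2^-1 *: (g + h).

(** Additivity of the l1 norm on vectors with successive supports. *)
Lemma l1norm_midpoint g h : (forall i, (i < size g)%N -> h`_i = 0) ->
  l1norm (midpoint g h) = (l1norm g + l1norm h) / 2.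
Proof.
move=> gh; set N := maxn (size g) (size h).
have gN : (size g <= N)%N by exact: leq_maxl.
have hN : (size h <= N)%N by exact: leq_maxr.
rewrite (@l1normE N); last first.
  by rewrite (leq_trans (size_scale_leq _ _))// (leq_trans (size_polyD _ _)).
rewrite (l1normE gN) (l1normE hN) -big_split/= mulrC mulr_sumr.
apply: eq_bigr => i _; rewrite coefZ coefD normrM ger0_norm ?invr_ge0//.
congr (_ * _); have [ig|gi] := ltnP i (size g).
  by rewrite gh// normr0 !addr0.
by rewrite (nth_default _ gi) normr0 !add0r.
Qed.

Context (Y : normedModType R).
Implicit Types a : nat -> dual Y.

(** The combination of the functionals a i with coefficients u. *)
Definition combination a u : dual Y := \sum_(i < size u) u`_i *: a i.

Lemma combinationE a N u : (size u <= N)%N -> combination a u = \sum_(i < N) u`_i *: a i.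
Proof.
move=> uN; rewrite /combination -(subnKC uN) big_split_ord/=.
rewrite [X in _ = _ + X]big1 ?addr0// => i _.
by rewrite nth_default ?scale0r// leq_addr.
Qed.

Lemma combinationN a u : combination a (- u) = - combination a u.
Proof.
rewrite /combination size_polyN -sumrN; apply: eq_bigr => i _.
by rewrite coefN scaleNr.
Qed.

Lemma combination_midpoint a g h :
  combination a (midpoint g h) = midpoint (combination a g) (combination a h).
Proof.
set N := maxn (size g) (size h).
have gN : (size g <= N)%N by exact: leq_maxl.
have hN : (size h <= N)%N by exact: leq_maxr.
rewrite (@combinationE _ N); last first.
  by rewrite (leq_trans (size_scale_leq _ _))// (leq_trans (size_polyD _ _)).
rewrite (combinationE _ gN) (combinationE _ hN) /midpoint -big_split/= scaler_sumr.
by apply: eq_bigr => i _; rewrite coefZ coefD -scalerDl scalerA.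
Qed.

Lemma combination_le a u x : (forall i, `|a i| <= 1) ->
  `|combination a u x : R| <= l1norm u * `|x|.
Proof.
move=> a1; rewrite dual_sumE /l1norm mulr_suml.
apply: (le_trans (ler_norm_sum _ _ _)); apply: ler_sum => i _.
rewrite dualZE normrM ler_wpM2l// (le_trans (ler_dual _ _))//.
by rewrite ler_piMl.
Qed.

(** Boolean independence across a gap makes a sequence equivalent to the basis of
l1: test on the difference of two points realizing opposite sign patterns. *)
Lemma independent_l1 a (r s : R) : r < s ->
  (forall (c : nat -> bool) N, exists2 x : Y, unit_ball Y x & forall k, (k < N)%N ->
     side (fun (p : dual Y) (x : Y) => p x : R) r s (c k) (a k) x) ->
  forall u, (s - r) / 2 * l1norm u <= `|combination a u|.
Proof.
move=> rs ind u.
have [x x1 xP] := ind (fun i => 0 <= u`_i) (size u).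
have [y y1 yP] := ind (fun i => ~~ (0 <= u`_i)) (size u).
have n1 : `|2^-1 *: (x - y)| <= 1.
  rewrite normrZ ger0_norm ?invr_ge0// ler_pdivrMl// mulr1.
  by rewrite (le_trans (ler_normB _ _))// (_ : 2 = 1 + 1 :> R)// lerD.
apply: le_trans (ler_dual_unit _ n1); apply: le_trans (ler_norm _).
rewrite dual_scaler dual_subr mulrAC mulrC ler_pM2l ?invr_gt0//.
rewrite !dual_sumE -sumrB /l1norm mulr_sumr; apply: ler_sum => i _.
rewrite !dualZE -mulrBr.
have := xP i (ltn_ord i); have := yP i (ltn_ord i); rewrite /side.
case: (leP 0 u`_i) => u0 /= hy hx.
  by rewrite ger0_norm// mulrC ler_wpM2l//; lra.
rewrite ltr0_norm//; nra.
Qed.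

End CoefficientNorm.

(** * Averages over words of signs *)

Section WordAverages.
Context (R : realType).

(** The average of F over the words of length N. *)
Fixpoint word_mean (V : lmodType R) N (F : seq bool -> V) : V :=
  if N is k.+1 then
    midpoint (word_mean k (fun w => F (true :: w))) (word_mean k (fun w => F (false :: w)))
  else F [::].

(** The same average for real-valued functions. *)
Fixpoint word_meanr N (F : seq bool -> R) : R :=
  if N is k.+1 then
    (word_meanr k (fun w => F (true :: w)) + word_meanr k (fun w => F (false :: w))) / 2
  else F [::].

Lemma word_mean_closed (V : lmodType R) (C : set V) N (F : seq bool -> V) :
  (forall g h, C g -> C h -> C (midpoint g h)) ->
  (forall w, size w = N -> C (F w)) -> C (word_mean N F).
Proof.
move=> CC; elim: N F => [|N IH] F CF /=; first exact: CF.
by apply: CC; apply: IH => w wN; apply: CF; rewrite /= wN.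
Qed.

Lemma dual_midpoint (Y : normedModType R) (p q : dual Y) x :
  midpoint p q x = (p x + q x) / 2 :> R.
Proof. by rewrite mulrC. Qed.

Lemma dual_word_mean (Y : normedModType R) N (F : seq bool -> dual Y) x :
  word_mean N F x = word_meanr N (fun w => F w x : R) :> R.
Proof.
elim: N F => [//|N IH F]; rewrite -[word_mean _ _]/(midpoint _ _) dual_midpoint !IH.
by [].
Qed.

Lemma combination_word_mean (Y : normedModType R) (a : nat -> dual Y) N
    (F : seq bool -> {poly R}) :
  combination a (word_mean N F) = word_mean N (fun w => combination a (F w)).
Proof. by elim: N F => //= N IH F; rewrite combination_midpoint !IH. Qed.

Lemma eq_word_meanr N F G : (forall w, size w = N -> F w = G w) ->
  word_meanr N F = word_meanr N G.
Proof.
elim: N F G => [|N IH] F G FG /=; first exact: FG.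
by congr ((_ + _) / _); apply: IH => w wN; apply: FG; rewrite /= wN.
Qed.

Lemma word_meanr_le N F (M : R) : (forall w, size w = N -> F w <= M) ->
  word_meanr N F <= M.
Proof.
elim: N F => [|N IH] F FM /=; first exact: FM.
have h1 := IH (fun w => F (true :: w)) (fun w wN => FM (true :: w) (congr1 S wN)).
have h2 := IH (fun w => F (false :: w)) (fun w wN => FM (false :: w) (congr1 S wN)).
lra.
Qed.

Lemma word_meanrN N F : word_meanr N (fun w => - F w) = - word_meanr N F.
Proof. by elim: N F => //= N IH F; rewrite !IH; lra. Qed.

Lemma word_meanr_ge N F (M : R) : (forall w, size w = N -> M <= F w) ->
  M <= word_meanr N F.
Proof.
move=> MF; rewrite -[word_meanr _ _]opprK -word_meanrN lerNr.
by apply: word_meanr_le => w wN; rewrite lerN2 MF.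
Qed.

(** If a mean almost attains an upper bound, so does each term. *)
Lemma word_meanr_extremal N F (M t : R) : (forall w, size w = N -> F w <= M) ->
  M - t <= word_meanr N F -> forall w, size w = N -> M - 2 ^+ N * t <= F w.
Proof.
elim: N F t => [|N IH] F t FM /= h w wN.
  by move: wN => /size0nil ->; rewrite expr0 mul1r.
have h1 := @word_meanr_le N (fun w => F (true :: w)) M
  (fun w wN => FM (true :: w) (congr1 S wN)).
have h2 := @word_meanr_le N (fun w => F (false :: w)) M
  (fun w wN => FM (false :: w) (congr1 S wN)).
case: w wN => // -[] w [wN]; rewrite exprSr -mulrA.
  by apply: (IH (fun w => F (true :: w))) => // [v vN|]; [apply: FM; rewrite /= vN|lra].
by apply: (IH (fun w => F (false :: w))) => // [v vN|]; [apply: FM; rewrite /= vN|lra].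
Qed.

Definition bool_sign (b : bool) : R := if b then 1 else -1.

(** Bessel's inequality for the Rademacher functions. *)
Lemma word_Bessel N F :
  \sum_(i < N) (word_meanr N (fun w => bool_sign (nth false w i) * F w)) ^+ 2 +
    (word_meanr N F) ^+ 2 <= word_meanr N (fun w => F w ^+ 2).
Proof.
elim: N F => [|N IH] F; first by rewrite big_ord0 add0r.
rewrite big_ord_recl /=.
have IH1 := IH (fun w => F (true :: w)); have IH2 := IH (fun w => F (false :: w)).
set e1 := word_meanr N (fun w => F (true :: w)) in IH1 *.
set e2 := word_meanr N (fun w => F (false :: w)) in IH2 *.
have -> : word_meanr N (fun w => bool_sign true * F (true :: w)) = e1.
  by apply: eq_word_meanr => w _; rewrite mul1r.
have -> : word_meanr N (fun w => bool_sign false * F (false :: w)) = - e2.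
  by rewrite -word_meanrN; apply: eq_word_meanr => w _; rewrite mulN1r.
have sumle : \sum_(i < N) ((word_meanr N (fun w => bool_sign (nth false w i) * F (true :: w)) +
     word_meanr N (fun w => bool_sign (nth false w i) * F (false :: w))) / 2) ^+ 2 <=
   (\sum_(i < N) (word_meanr N (fun w => bool_sign (nth false w i) * F (true :: w))) ^+ 2 +
   \sum_(i < N) (word_meanr N (fun w => bool_sign (nth false w i) * F (false :: w))) ^+ 2) / 2.
  rewrite -big_split mulr_suml /=; apply: ler_sum => i _.
  by move: (word_meanr _ _) (word_meanr _ _) => p q; have := sqr_ge0 (p - q); nra.
move: IH1 IH2 sumle; move: (\sum_(i < N) _) (\sum_(i < N) _) (\sum_(i < N) _) => s1 s2 s3.
move: (word_meanr _ _) (word_meanr _ _) => m1 m2 IH1 IH2 sumle.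
nra.
Qed.

Lemma eventually_words (P : seq bool -> nat -> Prop) N :
  (forall w, exists M, forall m, (M <= m)%N -> P w m) ->
  exists M, forall w, size w = N -> forall m, (M <= m)%N -> P w m.
Proof.
move=> /choice[M MP]; exists (\max_(t : N.-tuple bool) M t) => w wN m Mm.
have wN' : size w == N by apply/eqP.
apply: MP; apply: leq_trans Mm.
exact: (@leq_bigmax _ (fun t : N.-tuple bool => M t) (Tuple wN')).
Qed.

(** Picking terms with successive supports, the mean keeps l1 norm 1. *)
Lemma word_mean_l1norm N (V : seq bool -> nat -> {poly R}) (s m : nat) :
  (forall w k, l1norm (V w k) = 1) ->
  (forall w s, exists K, forall k, (K <= k)%N -> forall i, (i < s)%N -> (V w k)`_i = 0) ->
  exists F, [/\ forall w, size w = N -> exists2 k, (m <= k)%N & F w = V w k,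
    l1norm (word_mean N F) = 1 & forall i, (i < s)%N -> (word_mean N F)`_i = 0].
Proof.
elim: N V s => [|N IH] V s V1 Vs.
  have [K VK] := Vs [::] s.
  exists (fun w => V w (maxn K m)); split=> //=; last by apply: VK; exact: leq_maxl.
  by move=> w _; exists (maxn K m) => //; exact: leq_maxr.
have [F1 [F1V n1 z1]] := IH (fun w => V (true :: w)) s (fun w => V1 _) (fun w => Vs _).
have [F2 [F2V n2 z2]] := IH (fun w => V (false :: w))
  (maxn s (size (word_mean N F1))) (fun w => V1 _) (fun w => Vs _).
exists (fun w => if w is b :: w' then if b then F1 w' else F2 w' else 0).
split=> /=.
- by case=> // -[] w [wN]; [exact: F1V|exact: F2V].
- rewrite l1norm_midpoint ?n1 ?n2; first by field.
  by move=> i ilt; apply: z2; rewrite (leq_trans ilt)// leq_maxr.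
- move=> i ilt; rewrite coefZ coefD z1// z2 ?addr0 ?mulr0//.
  by rewrite (leq_trans ilt)// leq_maxl.
Qed.

End WordAverages.

(** * Blocks and the tree of signs *)

Section HaglerJohnson.
Context (R : realType) (Y : normedModType R) (a : nat -> dual Y).
Hypothesis a1 : forall i, `|a i| <= 1.
Implicit Types (u v : nat -> {poly R}) (x : Y).

Let T := combination a.

(** Symmetric midpoint-convex sets. *)
Definition symmetric_convex (C : set {poly R}) : Prop :=
  (forall g h, C g -> C h -> C (midpoint g h)) /\ (forall g, C g -> C (- g)).

(** The smallest symmetric midpoint-convex set containing G. *)
Definition hull (G : set {poly R}) : set {poly R} :=
  [set g | forall C, symmetric_convex C -> G `<=` C -> C g].

Lemma hull_sub G : G `<=` hull G.
Proof. by move=> g Gg C _; apply. Qed.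

Lemma hull_mono G H : G `<=` H -> hull G `<=` hull H.
Proof. by move=> GH g hg C CC HC; apply: hg => // h /GH; exact: HC. Qed.

Lemma hull_convex G : symmetric_convex (hull G).
Proof.
split=> [g h hg hh|g hg] C CC GC.
  by apply: CC.1; [exact: hg|exact: hh].
by apply: CC.2; exact: hg.
Qed.

Lemma hull_idem G : hull (hull G) `<=` hull G.
Proof. by move=> g; apply=> //; exact: hull_convex. Qed.

(** Blocks: sequences of l1-normalized vectors eventually in the hull of each
tail of the given one. *)
Definition blocks := @refines {poly R} [set u | l1norm u = 1] hull.

Let blocks_refl u : (forall n, l1norm (u n) = 1) -> blocks u u.
Proof. exact: (@refines_refl _ _ _ hull_sub). Qed.

Let blocks_trans v u w : blocks v u -> blocks w v -> blocks w u.
Proof. exact: (@refines_trans _ _ _ hull_mono hull_idem). Qed.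

Let monomials (n : nat) : {poly R} := 'X^n.

Lemma blocks_monomials_tail v s : blocks v monomials ->
  exists K, forall k, (K <= k)%N -> forall i, (i < s)%N -> (v k)`_i = 0.
Proof.
move=> [_ vm]; have [K vK] := vm s; exists K => k /vK.
move=> /(_ [set g : {poly R} | forall i, (i < s)%N -> g`_i = 0]); apply.
  split=> [g h g0 h0 i si|g g0 i si]; last by rewrite coefN g0// oppr0.
  by rewrite coefZ coefD g0// h0// addr0 mulr0.
move=> _ [n /= sn <-] i si; rewrite coefXn lt_eqF//.
by rewrite ltEnat/= (leq_trans si).
Qed.

(** The nonnegative numbers eventually bounding |T (u m) x|, for each x in the unit
ball. *)
Definition asymptotic_bound u : set R := [set d | 0 <= d /\
  forall x, `|x| <= 1 -> exists M, forall m, (M <= m)%N -> `|T (u m) x : R| <= d].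

Lemma asymptotic_bound_blocks v u : blocks v u ->
  asymptotic_bound u `<=` asymptotic_bound v.
Proof.
move=> [_ vu] d [d0 ud]; split=> // x x1; have [M uM] := ud x x1.
have [M' vM'] := vu M; exists M' => m /vM'.
move=> /(_ [set g | `|T g x : R| <= d]); apply.
  split=> [g h /= gd hd|g /= gd].
    rewrite /T combination_midpoint dual_midpoint normrM [`|2^-1|]ger0_norm ?invr_ge0//.
    rewrite ler_pdivrMr//; apply: (le_trans (abs_leD _ _)).
    by move: gd hd; rewrite /T; lra.
  by rewrite /T combinationN dualNE normrN.
by move=> _ [n /= Mn <-]; exact: uM.
Qed.

Lemma asymptotic_bound1 u : (forall n, l1norm (u n) = 1) -> asymptotic_bound u 1.
Proof.
move=> u1; split=> // x x1; exists 0%N => m _.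
by rewrite (le_trans (combination_le _ _ a1))// u1 mul1r.
Qed.

(** The asymptotic size of u: the supremum over the unit ball of
limsup_n |T (u n) x|. *)
Definition asymptotic_size u : R := inf (asymptotic_bound u).

Lemma asymptotic_size_lb u : has_lbound (asymptotic_bound u).
Proof. by exists 0 => d []. Qed.

Lemma asymptotic_size_blocks u v : (forall n, l1norm (u n) = 1) -> blocks v u ->
  0 <= asymptotic_size v <= asymptotic_size u.
Proof.
move=> u1 vu; apply/andP; split.
  apply: lb_le_inf; last by move=> d [].
  by exists 1; apply: asymptotic_bound1; have [] := vu.
apply: lb_le_inf; first by exists 1; exact: asymptotic_bound1.
move=> d ud; apply: ge_inf; first exact: asymptotic_size_lb.
exact: asymptotic_bound_blocks vu _ ud.
Qed.

Lemma asymptotic_size_gt u d x : (forall n, l1norm (u n) = 1) ->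
  asymptotic_size u < d -> `|x| <= 1 ->
  exists M, forall m, (M <= m)%N -> `|T (u m) x : R| <= d.
Proof.
move=> u1 ud x1.
have h : has_inf (asymptotic_bound u).
  by split; [exists 1; exact: asymptotic_bound1|exact: asymptotic_size_lb].
have e0 : 0 < d - asymptotic_size u by rewrite subr_gt0.
have [d' [_ /(_ x x1)[M HM]] d'd] := inf_adherent e0 h.
exists M => m /HM h'; apply: (le_trans h'); apply: ltW.
by move: d'd; rewrite addrC subrK.
Qed.

Lemma asymptotic_size_lt u d : 0 <= d -> d < asymptotic_size u ->
  exists2 x, `|x| <= 1 & forall M, exists2 m, (M <= m)%N & d < `|T (u m) x : R|.
Proof.
move=> d0 du; apply: contrapT => h.
suff : asymptotic_size u <= d by rewrite leNgt du.
apply: ge_inf; first exact: asymptotic_size_lb.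
split=> // x x1; apply: contrapT => hx; apply: h; exists x => // M.
apply: contrapT => hM; apply: hx; exists M => m Mm.
by rewrite leNgt; apply/negP => dT; apply: hM; exists m.
Qed.

(** One step of the tree: all the branches of level N are split, according to the
sign of the values at one new vector x. *)
Lemma tree_step u N (V : seq bool -> nat -> {poly R}) : blocks u monomials ->
  0 < asymptotic_size u ->
  (forall v, blocks v u -> asymptotic_size v = asymptotic_size u) ->
  (forall w, blocks (V w) u) ->
  exists x (V' : seq bool -> nat -> {poly R}), [/\ `|x| <= 1,
    forall w, blocks (V' w) u,
    forall b w k, size w = N -> exists j, V' (b :: w) k = V w j &
    forall b w k, size w = N ->
      asymptotic_size u / 2 <= bool_sign R b * (T (V' (b :: w) k) x : R)].
Proof.
move=> um D0 ustable Vu; set D := asymptotic_size u in D0 ustable *.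
have u1 : forall n, l1norm (u n) = 1 := um.1.
(* the first letter of a word of length N + 1 is the sign given to the block *)
pose W (l : seq bool) k := if l is b :: w then if b then V w k else - V w k else u k.
have W1 l k : l1norm (W l k) = 1.
  by case: l => [|[] w] /=; rewrite ?l1normN; [exact: u1|exact: (Vu w).1|exact: (Vu w).1].
have Wtail l s : exists K, forall k, (K <= k)%N -> forall i, (i < s)%N -> (W l k)`_i = 0.
  case: l => [|b w]; first exact: blocks_monomials_tail.
  have [K VK] := blocks_monomials_tail s (blocks_trans um (Vu w)).
  by exists K => k Kk i si; case: b; rewrite /= ?coefN VK// oppr0.
have /choice[F FE] : forall m, exists F, [/\ forall l, size l = N.+1 ->
      exists2 k, (m <= k)%N & F l = W l k & l1norm (word_mean N.+1 F) = 1].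
  move=> m; have [F [h1 h2 _]] := @word_mean_l1norm R N.+1 W 0%N m W1 Wtail.
  by exists F.
pose z m := word_mean N.+1 (F m).
have zu : blocks z u.
  split=> [m|M0]; first by have [] := FE m.
  have [|M HM] := @eventually_words (fun l k => hull (tail_set u M0) (W l k)) N.+1.
    case=> [|b w]; first by exists M0 => m Mm; apply: hull_sub; exists m.
    have [_ /(_ M0)[M HM]] := Vu w; exists M => m /HM h.
    by case: b => //; apply: (hull_convex _).2.
  exists M => m Mm; apply: word_mean_closed; first exact: (hull_convex _).1.
  move=> l lN; have [/(_ l lN)[k mk ->] _] := FE m.
  by apply: HM => //; exact: leq_trans mk.
(* the terms are eventually at most D + eta and their mean over 2 ^ (N+1) words is
   more than D - eta, so each is at least D + eta - 2 ^ (N+1) * 2 eta >= D / 2 *)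
pose eta := D / 2 ^+ N.+3.
have p0 : 0 < 2 ^+ N.+1 :> R by rewrite exprn_gt0.
have pE : 2 ^+ N.+3 = 4 * 2 ^+ N.+1 :> R by rewrite !exprS; ring.
have eta0 : 0 < eta by rewrite divr_gt0// exprn_gt0.
have etaE : 2 ^+ N.+1 * (2 * eta) = D / 2.
  by rewrite /eta pE; field; rewrite expf_neq0.
have etaD : eta <= D.
  by rewrite ler_pdivrMr ?exprn_gt0// ler_peMr ?(ltW D0)// exprn_ege1// ler1n.
have zD : asymptotic_size z = D by exact: ustable.
have [||x0 x01 x0P] := @asymptotic_size_lt z (D - eta).
- by rewrite subr_ge0.
- by rewrite zD ltrBlDr ltrDl.
(* up to the sign of [x0], the means exceed D - eta infinitely often *)
have [x x1 xP] : exists2 x, `|x| <= 1 &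
    forall M, exists2 m, (M <= m)%N & D - eta < (T (z m) x : R).
  have [h|h] := pselect (forall M, exists2 m, (M <= m)%N & D - eta < (T (z m) x0 : R)).
    by exists x0.
  exists (- x0); first by rewrite normrN.
  move: h => /existsNP[M0 h] M.
  have [m] := x0P (maxn M0 M); rewrite geq_max => /andP[M0m Mm] hm.
  exists m => //; rewrite dual_oppr.
  have [T0|T0] := leP 0 (T (z m) x0 : R); last by move: hm; rewrite ltr0_norm.
  by exfalso; apply: h; exists m => //; move: hm; rewrite ger0_norm.
have [|J HJ] := @eventually_words (fun l k => `|T (W l k) x : R| <= D + eta) N.+1.
  move=> l; have [M HM] : exists M, forall m, (M <= m)%N ->
      `|T (if l is _ :: w then V w m else u m) x : R| <= D + eta.
    case: l => [|b w]; first by apply: asymptotic_size_gt => //; rewrite ltrDl.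
    by apply: asymptotic_size_gt => //; [exact: (Vu w).1|rewrite ustable// ltrDl].
  exists M => m /HM; case: l {HM} => // -[] w //=.
  by rewrite /T combinationN dualNE normrN.
have /choice[mk mkE] : forall k, exists m, (maxn J k <= m)%N /\ D - eta < (T (z m) x : R).
  by move=> k; have [m] := xP (maxn J k); exists m.
have big k l : size l = N.+1 -> D / 2 <= (T (F (mk k) l) x : R).
  move=> lN; have [] := mkE k; rewrite geq_max => /andP[Jm km] hz.
  have := @word_meanr_extremal R N.+1 (fun l => T (F (mk k) l) x : R) (D + eta) (2 * eta).
  rewrite etaE => h; apply: le_trans (h _ _ l lN); first lra.
    move=> l' l'N; have [/(_ l' l'N)[j mj ->] _] := FE (mk k).
    by apply: le_trans (ler_norm _) _; apply: HJ => //; exact: leq_trans mj.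
  rewrite -dual_word_mean -combination_word_mean -/(z _) -/T; lra.
pose V' (l : seq bool) k := if l is b :: w then
  (if size w == N then (if b then F (mk k) l else - F (mk k) l) else u k) else u k.
have V'V b w k : size w = N -> exists2 j, (k <= j)%N & V' (b :: w) k = V w j.
  move=> wN; rewrite /V' wN eqxx.
  have [/(_ (b :: w))/=] := FE (mk k); rewrite wN => /(_ erefl)[j mj FW] _.
  have [] := mkE k; rewrite geq_max => /andP[_ km] _.
  exists j; first exact: leq_trans mj.
  by case: b FW => ->; rewrite ?opprK.
exists x, V'; split => //.
- case=> [|b w]; first exact: blocks_refl.
  have [wN|wN] := eqVneq (size w) N; last first.
    by rewrite /V' (negbTE wN); exact: blocks_refl.
  apply: blocks_trans (Vu w) _; apply: refines_pick; first exact: hull_sub.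
    by move=> m; have [j _ ->] := V'V b w m wN; exact: (Vu w).1.
  by move=> m; exact: V'V.
- by move=> b w k wN; have [j _ ->] := V'V b w k wN; exists j.
move=> b w k wN; rewrite /V' wN eqxx.
have := big k (b :: w) (congr1 S wN).
case: b => h; first by rewrite mul1r.
by rewrite /T combinationN dualNE mulN1r opprK.
Qed.

End HaglerJohnson.

(** * Null sequences from l1-sequences *)

Section NullSequences.
Context (R : realType) (Y : normedModType R).

Lemma null_of_unit_ball (q : nat -> dual Y) :
  (forall x e, `|x| <= 1 -> 0 < e ->
     exists M, forall m, (M <= m)%N -> `|q m x : R| <= e) ->
  forall x, (q n x : R) @[n --> \oo] --> (0 : R).
Proof.
move=> H x; apply/(@cvgrPdist_le R R^o) => e e0.
have x1 : 0 < `|x| + 1 by rewrite ltr_wpDl.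
have [||M HM] := H ((`|x| + 1)^-1 *: x) (e / (`|x| + 1)).
- by rewrite normrZ ger0_norm ?invr_ge0 ?(ltW x1)// ler_pdivrMl// mulr1 lerDl.
- by rewrite divr_gt0.
exists M => // m /= /HM.
rewrite sub0r normrN dual_scaler normrM ger0_norm ?invr_ge0 ?(ltW x1)//.
by rewrite mulrC ler_pM2r ?invr_gt0.
Qed.

Lemma square_summable_null (f : nat -> R) (C : R) :
  (forall m, \sum_(n < m) f n ^+ 2 <= C) -> f n @[n --> \oo] --> (0 : R).
Proof.
move=> fC.
have nd : nondecreasing_seq (series (fun n => f n ^+ 2)).
  by apply: nondecreasing_series => n _ _; exact: sqr_ge0.
have /cvg_series_cvg_0 f20 : cvgn (series (fun n => f n ^+ 2)).
  apply: nondecreasing_is_cvgn => //; exists C => _ [m _ <-].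
  by rewrite /series/= big_mkord.
apply/(@cvgrPdist_lt R R^o) => e e0.
have /cvgrPdist_lt/(_ (e ^+ 2))[|N _ HN] := f20; first exact: exprn_gt0.
exists N => // n /HN; rewrite !sub0r !normrN normrX.
by rewrite ltr_pXn2r// nnegrE ltW.
Qed.

Context (a : nat -> dual Y).
Hypothesis a1 : forall i, `|a i| <= 1.
Let T := combination a.

(** If some block sequence keeps the same positive size for all its own blocks,
the tree of signs yields a weak* square-summable sequence, bounded below. *)
Lemma stable_blocks_null u : blocks u (fun n => 'X^n) -> 0 < asymptotic_size a u ->
  (forall v, blocks v u -> asymptotic_size a v = asymptotic_size a u) ->
  exists (q : nat -> dual Y) (e : R), [/\ 0 < e, forall n, e <= `|q n| &
    forall x, (q n x : R) @[n --> \oo] --> (0 : R)].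
Proof.
move=> um D0 ustable; set D := asymptotic_size a u in D0 ustable *.
pose st := {V : seq bool -> nat -> {poly R} | forall w, blocks (V w) u}.
pose ok N (V : st) (t : Y * st) := [/\ `|t.1| <= 1,
    forall b w k, size w = N -> exists j, sval t.2 (b :: w) k = sval V w j &
    forall b w k, size w = N ->
      D / 2 <= bool_sign R b * (T (sval t.2 (b :: w) k) t.1 : R)].
have ex N (V : st) : {t | ok N V t}.
  apply: cid; have [x [V' [x1 V'u V'V V'x]]] := tree_step a1 N um D0 ustable (svalP V).
  by exists (x, exist _ V' V'u); split.
have u1 : forall n, l1norm (u n) = 1 := um.1.
pose g := fix g N : st := if N is k.+1 then (sval (ex k (g k))).2 else
  exist (fun V => forall w, blocks (V w) u) (fun=> u)
    (fun=> (@refines_refl _ _ _ (@hull_sub R) u u1)).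
pose V N := sval (g N).
pose x N := (sval (ex N (g N))).1.
have xP N : ok N (g N) (sval (ex N (g N))) by exact: svalP.
have Vx N w k n : size w = N -> (n < N)%N ->
    D / 2 <= bool_sign R (nth false w (N.-1 - n)) * (T (V N w k) (x n) : R).
  elim: N w k => // N IH [|b w]// k [wN] /=; have [x1 VV VD] := xP N.
  rewrite ltnS leq_eqVlt => /predU1P[->|nN].
    by rewrite subnn /=; exact: VD.
  have [j Vj] := VV b w k wN.
  have -> : nth false (b :: w) (N - n) = nth false w (N.-1 - n).
    by rewrite -(ltn_predK nN) subSn// -ltnS (ltn_predK nN).
  by have := IH w j wN nN; rewrite /V /= Vj.
have Vle N w k y : `|T (V N w k) y : R| <= `|y|.
  rewrite (le_trans (combination_le _ _ a1))//.
  by have -> : l1norm (V N w k) = 1 := (svalP (g N) w).1 k; rewrite mul1r.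
(* the letter of index N - 1 - n in a word of length N is the sign at [x n] *)
pose P N n : dual Y := word_mean N (fun w => bool_sign R (nth false w (N.-1 - n)) *: T (V N w 0%N)).
have PE N n y : P N n y = word_meanr N (fun w => bool_sign R (nth false w (N.-1 - n)) *
    (T (V N w 0%N) y : R)) :> R by rewrite /P dual_word_mean.
have sgn1 b (r : R) : `|bool_sign R b * r| = `|r|.
  by rewrite normrM /bool_sign; case: b; rewrite ?normrN normr1 mul1r.
have Ple N n y : `|P N n y : R| <= `|y|.
  rewrite PE ler_norml; apply/andP; split.
    by apply: word_meanr_ge => w _; rewrite lerNl (le_trans (ler_norm _))// normrN sgn1.
  by apply: word_meanr_le => w _; rewrite (le_trans (ler_norm _))// sgn1.
have [U [UU Uoo]] := ultra_eventually.
have [q qP] : exists q : nat -> dual Y, forall n y, (P N n y : R) @[N --> U] --> (q n y : R).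
  suff /choice[q qP] : forall n, exists q : dual Y, forall y,
      (P N n y : R) @[N --> U] --> (q y : R).
    by exists q.
  move=> n; have [||y|q _ qP] := @pointwise_limit_dual R Y nat U (fun N => P N n) 1.
  - exact: ler01.
  - apply: Uoo; near=> N; apply: dual_norm_leP => y y1; exact: le_trans (Ple _ _ _) y1.
  - apply: (@ultra_bounded_cvg R nat U (fun N => P N n y) `|y| UU).
    by apply: Uoo; near=> N; exact: Ple.
  - by exists q.
exists q, (D / 2); split=> [|n|y]; first by rewrite divr_gt0.
  have xn1 : `|x n| <= 1 by have [] := xP n.
  apply: le_trans (ler_dual_unit _ xn1); apply: le_trans (ler_norm _).
  rewrite -lerN2; apply: (real_cvg_le (cvgN (qP n (x n)))).
  apply: Uoo; exists n.+1 => // N /= nN; rewrite lerN2 PE.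
  by apply: word_meanr_ge => w wN; exact: Vx.
apply: (@square_summable_null _ (`|y| ^+ 2)) => m.
have sumq : (\sum_(n < m) (P N n y : R) ^+ 2) @[N --> U] --> \sum_(n < m) (q n y : R) ^+ 2.
  have h i : (P N i y : R) ^+ 2 @[N --> U] --> (q i y : R) ^+ 2 by apply: cvgM; exact: qP.
  have UF : Filter U by exact: (@filter_filter _ _ (@ultra_proper _ _ UU)).
  exact: (@real_cvg_sum R nat U UF (fun n N => (P N n y : R) ^+ 2) (fun n => (q n y : R) ^+ 2) m h).
apply: (real_cvg_le sumq); apply: Uoo; exists m => // N /= mN.
apply: (@le_trans _ _ (\sum_(n < N) (P N n y : R) ^+ 2)).
  rewrite -(subnKC mN) big_split_ord /= lerDl; apply: sumr_ge0 => i _.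
  exact: sqr_ge0.
rewrite (reindex_inj rev_ord_inj) /=.
apply: (@le_trans _ _ (word_meanr N (fun w => (T (V N w 0%N) y : R) ^+ 2))).
  apply: le_trans (@word_Bessel R N (fun w => T (V N w 0%N) y : R)).
  apply: ler_wpDr; first exact: sqr_ge0.
  apply: ler_sum => i _; rewrite PE.
  rewrite (_ : (N.-1 - (N - i.+1))%N = i)//.
  by case: N mN i => [|N] mN [i iN]//=; rewrite subSS subKn.
apply: word_meanr_le => w _; rewrite -[X in X <= _]real_normK ?num_real//.
by rewrite lerXn2r ?nnegrE.
Unshelve. all: by end_near. Qed.

(** Hagler--Johnson: a sequence of functionals equivalent to the basis of l1 gives a
weak* null sequence bounded below. *)
Lemma l1_sequence_null (c : R) : 0 < c ->
  (forall u, c * l1norm u <= `|T u|) ->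
  exists (q : nat -> dual Y) (e : R), [/\ 0 < e, forall n, e <= `|q n| &
    forall x, (q n x : R) @[n --> \oo] --> (0 : R)].
Proof.
move=> c0 cT.
have m1 n : l1norm ('X^n : {poly R}) = 1 by exact: l1normXn.
have [v w vm wv|u um ustable] :=
  @refines_stable {poly R} [set v | l1norm v = 1] (@hull R) (@hull_sub R) (@hull_mono R)
   (@hull_idem R) R (asymptotic_size a) (fun n => 'X^n) m1.
  by apply: (asymptotic_size_blocks a1) wv; have [] := vm.
have [D0|D0] := ltP 0 (asymptotic_size a u); first exact: (stable_blocks_null um D0).
exists (fun n => T (u n)), c; split=> // [n|].
  by have := cT (u n); rewrite (um.1 n) mulr1.
apply: null_of_unit_ball => x e x1 e0.
by apply: (asymptotic_size_gt a1 um.1) => //; exact: le_lt_trans e0.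
Qed.

End NullSequences.

(** * The Josefson--Nissenzweig theorem *)

Section JosefsonNissenzweig.
Context (R : realType) (Y : normedModType R).

Lemma weakstar_nullP (p : nat -> dual Y) :
  weakstar_null p <-> forall x, (p n x : R) @[n --> \oo] --> (0 : R).
Proof. exact: weakstar_cvgP. Qed.

(** The Josefson--Nissenzweig theorem, combining Rosenthal's dichotomy for a separated
sequence of functionals with the case of an l1-sequence. *)
Theorem Josefson_Nissenzweig : infinite_dimensional Y ->
  exists (q : nat -> dual Y) (e : R), [/\ 0 < e, forall n, e <= `|q n| &
    forall x, (q n x : R) @[n --> \oo] --> (0 : R)].
Proof.
move=> /dual_separated_sequence[f [f1 fsep]].
pose ev (p : dual Y) (x : Y) : R := p x.
pose Q := [set p : dual Y | `|p| <= 1].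
have [p x|[v vf vcvg]|[r [s [v [rs vf vosc]]]]] :=
  @convergent_or_oscillating R (dual Y) Y ev Q f (@unit_ball R Y) 1 f1.
- move=> p1 x1; exact: le_trans (ler_dual_unit p x1) p1.
(* each term of [v] is some f i, and later terms are some f k with k > i *)
- have [M0 HM0] := vf.2 0%N.
  have sep n : exists m, (n + M0 <= m)%N /\ 1 <= `|v m - v (n + M0)%N|.
    have [i _ iE] := HM0 (n + M0)%N (leq_addl _ _).
    have [M HM] := vf.2 i.+1; exists (maxn M (n + M0)); split; first exact: leq_maxr.
    have [k /= ik kE] := HM _ (leq_maxl M (n + M0)).
    by rewrite -kE -iE fsep// gt_eqF.
  have /choice[m mE] := sep.
  exists (fun n => v (m n) - v (n + M0)%N), 1; split=> // [n|]; first by have [] := mE n.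
  apply: null_of_unit_ball => x e x1 e0.
  have [l /cvgrPdist_le/(_ (e / 2))[|N _ HN]] := vcvg x x1; first by rewrite divr_gt0.
  exists N => n Nn.
  have h1 := HN (n + M0)%N (leq_trans Nn (leq_addr _ _)).
  have h2 := HN (m n) (leq_trans Nn (leq_trans (leq_addr _ _) (mE n).1)).
  rewrite dualBE -[X in `|X|](_ : (l - ev (v (n + M0)%N) x) - (l - ev (v (m n)) x) = _).
    by apply: (le_trans (ler_normB _ _)); rewrite (splitr e) lerD.
  by rewrite /ev; ring.
have [a Qa aind] := oscillating_independent vf.1 vosc.
apply: (l1_sequence_null Qa (c := (s - r) / 2)); first by rewrite divr_gt0// subr_gt0.
exact: independent_l1 rs aind.
Qed.

Lemma JN_sequenceP (q : nat -> dual Y) (e : R) : 0 < e -> (forall n, e <= `|q n|) ->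
  (forall x, (q n x : R) @[n --> \oo] --> (0 : R)) -> JN_sequence q.
Proof.
move=> e0 qe q0; split; first exact/weakstar_nullP.
apply: lt_le_trans e0 _; apply: lb_le_inf; first by exists `|q 0%N|, 0%N.
by move=> _ [n _ <-].
Qed.

(** Dividing by the norms keeps a JN-sequence weak* null. *)
Lemma JN_normalized (p : nat -> dual Y) : JN_sequence p ->
  exists q : nat -> dual Y, (forall n, `|q n| = 1) /\
    forall x, (q n x : R) @[n --> \oo] --> (0 : R).
Proof.
move=> [/weakstar_nullP p0]; set e := inf _ => e0.
have ple n : e <= `|p n|.
  by apply: ge_inf; [exists 0 => _ [k _ <-]|exists n].
have pn0 n : 0 < `|p n| by exact: lt_le_trans (ple n).
exists (fun n => `|p n|^-1 *: p n); split=> [n|].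
  by rewrite normrZ normfV normr_id mulVf// gt_eqF.
apply: null_of_unit_ball => x d _ d0.
have /cvgrPdist_le/(_ (d * e))[|N _ HN] := p0 x; first exact: mulr_gt0.
exists N => n /HN; rewrite sub0r normrN dualZE normrM normfV normr_id => h.
rewrite ler_pdivrMl// (le_trans h)// mulrC ler_pM2r//.
Qed.

End JosefsonNissenzweig.

(** * A weak* continuous seminorm separating points *)

Section WeakStarTopology.
Context (R : realType) (Y : normedModType R).

Lemma weakstar_eval_continuous (x : Y) :
  continuous (fun p : weakstar Y => (p : dual Y) x : R).
Proof.
move=> p; pose ev (r : weakstar Y) : {ptws Y -> R^o} := @dual_fun R Y r.
have h : {ptws, ev @ nbhs p --> ev p} by exact: (@initial_continuous _ {ptws Y -> R^o} ev).
exact: ((pointwise_cvgP _ _).1 h).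
Qed.

Lemma weakstar_cvg (T : Type) (F : set_system T) (f : T -> dual Y) (q : dual Y) :
  Filter F -> (forall x, (f t x : R) @[t --> F] --> (q x : R)) ->
  (f : T -> weakstar Y) @ F --> (q : weakstar Y).
Proof.
move=> FF fq A [B [[C oC <-] Cq BA]].
have fq' : {ptws, (fun t => dual_fun (f t)) @ F --> dual_fun q}.
  by apply/pointwise_cvgP.
have : nbhs (dual_fun q : {ptws Y -> R^o}) C by exact: open_nbhs_nbhs.
move=> /fq' h; have {}h : F [set t | C (dual_fun (f t))] by exact: h.
by apply: (@filterS _ F FF _ [set t | A (f t)] _ h) => t Ct; exact: BA.
Qed.

(** A norm-separable set of functionals is separated by countably many vectors. *)
Lemma norm_separable_separated (K : set (dual Y)) : norm_separable K ->
  exists z : nat -> Y, (forall n, `|z n| <= n.+1%:R^-1) /\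
    forall p q, K p -> K q -> (forall n, p (z n) = q (z n)) -> p = q.
Proof.
move=> [D /countable_injP[f finj] [DK KD]].
(* [e] enumerates the countable dense set [D] *)
have /choice[e eE] : forall n, exists d : dual Y, forall d', D d' -> f d' = n -> d = d'.
  move=> n; have [[d [Dd fd]]|h] := pselect (exists d, D d /\ f d = n); last first.
    by exists 0 => d' Dd' fd'; exfalso; apply: h; exists d'.
  by exists d => d' Dd' fd'; apply: finj; rewrite ?inE ?fd ?fd'.
pose pr k : nat * nat := odflt (0%N, 0%N) (unpickle k).
(* for each pair of elements of the countable dense set, [x] attains at least half of
   the norm of their difference *)
have /choice[x xE] : forall k, exists x : Y, `|x| <= 1 /\
    `|e (pr k).1 - e (pr k).2| / 2 <= `|(e (pr k).1 - e (pr k).2) x : R|.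
  move=> k; set g := e _ - e _.
  have [->|g0] := eqVneq g 0; first by exists 0; rewrite !normr0 mul0r.
  have [|x x1 gx] := @dual_norm_ltP R Y g (`|g| / 2).
    by rewrite ltr_pdivrMr// ltr_pMr ?normr_gt0// ltr1n.
  by exists x; split=> //; exact: ltW.
exists (fun n => n.+1%:R^-1 *: x n); split=> [n|p q Kp Kq pq].
  rewrite normrZ ger0_norm ?invr_ge0// ler_piMr ?invr_ge0//; exact: (xE n).1.
have pqx n : p (x n) = q (x n) :> R.
  have c0 : n.+1%:R^-1 != 0 :> R by rewrite invr_eq0 pnatr_eq0.
  by have := pq n; rewrite !dual_scaler => /(mulfI c0).
apply/eqP; rewrite -subr_eq0 -normr_eq0; apply/negP => /negP pq0.
have t0 : 0 < `|p - q| by rewrite lt_def pq0 normr_ge0.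
set t := `|p - q| in t0 *.
have approx r : K r -> exists i, `|r - e i| < t / 8.
  move=> Kr; have [|d [Dd rd]] := KD r Kr (ball r (t / 8)).
    by apply: nbhsx_ballx; rewrite divr_gt0.
  by exists (f d); rewrite (eE (f d) d).
have [i pi] := approx p Kp; have [j qj] := approx q Kq.
have [x1] := xE (pickle (i, j)); rewrite /pr pickleK /= => h.
set y := x _ in x1 h.
have hpq : p y = q y :> R by exact: pqx.
have h1 : `|(p - e i) y : R| <= t / 8 by rewrite (le_trans (ler_dual_unit _ x1))// ltW.
have h2 : `|(q - e j) y : R| <= t / 8 by rewrite (le_trans (ler_dual_unit _ x1))// ltW.
have h3 : t <= t / 8 + `|e i - e j| + t / 8.
  rewrite {1}/t; have -> : p - q = (p - e i) + (e i - e j) + (e j - q) by rewrite !addrA !subrK.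
  rewrite (le_trans (ler_normD _ _))// lerD//; last by rewrite distrC ltW.
  by rewrite (le_trans (ler_normD _ _))// lerD// ltW.
have h4 : `|(e i - e j) y : R| <= t / 8 + t / 8.
  have -> : (e i - e j) y = (q - e j) y - (p - e i) y :> R.
    by rewrite !dualBE hpq; ring.
  by rewrite (le_trans (ler_normB _ _))// lerD.
lra.
Qed.

Section SupSeminorm.
Context (z : nat -> Y).
Hypothesis z_le : forall n, `|z n| <= n.+1%:R^-1.
Implicit Types p q : dual Y.

(** The seminorm sup_n |p (z n)|; since z tends to 0 in norm, it is weak*
continuous on bounded sets. *)
Definition sup_seminorm (p : dual Y) : R := sup [set `|p (z n) : R| | n in [set: nat]].

Lemma z_le1 n : `|z n| <= 1.
Proof. by rewrite (le_trans (z_le n))// invf_le1// ler1n. Qed.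

Lemma sup_seminorm_ub p n : `|p (z n) : R| <= sup_seminorm p.
Proof.
apply: ub_le_sup; last by exists n.
by exists `|p| => _ [k _ <-]; apply: ler_dual_unit; exact: z_le1.
Qed.

Lemma sup_seminorm_le p M : (forall n, `|p (z n) : R| <= M) -> sup_seminorm p <= M.
Proof. by move=> h; apply: ge_sup => [|_ [n _ <-]//]; exists `|p (z 0%N)|, 0%N. Qed.

Lemma sup_seminorm_le_norm p : sup_seminorm p <= `|p|.
Proof. by apply: sup_seminorm_le => n; apply: ler_dual_unit; exact: z_le1. Qed.

Lemma sup_seminorm_ge0 p : 0 <= sup_seminorm p.
Proof. exact: le_trans (abs_ge0 _) (sup_seminorm_ub p 0). Qed.

Lemma sup_seminorm_seminorm : seminorm sup_seminorm.
Proof.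
have hZ a p : sup_seminorm (a *: p) <= `|a| * sup_seminorm p.
  apply: sup_seminorm_le => n; rewrite dualZE normrM ler_wpM2l//.
  exact: sup_seminorm_ub.
split=> [p q|a p].
  apply: sup_seminorm_le => n; apply: (le_trans (abs_leD _ _)).
  by apply: lerD; exact: sup_seminorm_ub.
apply/eqP; rewrite eq_le hZ/=.
have [->|a0] := eqVneq a 0; first by rewrite normr0 mul0r sup_seminorm_ge0.
have := hZ a^-1 (a *: p); rewrite scalerA mulVf// scale1r normfV.
by rewrite ler_pdivlMl// normr_gt0.
Qed.

Lemma sup_seminormB p q : `|sup_seminorm p - sup_seminorm q| <= sup_seminorm (p - q).
Proof.
have [hD hZ] := sup_seminorm_seminorm.
have h1 := hD (p - q) q; rewrite subrK in h1.
have h2 := hD (q - p) p; rewrite subrK in h2.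
have h3 := hZ (-1) (p - q); rewrite scaleN1r opprB normrN normr1 mul1r in h3.
by rewrite ler_norml; apply/andP; split; lra.
Qed.

Lemma sup_seminorm_continuous : continuous sup_seminorm.
Proof.
move=> p; apply/(@cvgrPdist_lt R R (dual Y) (nbhs p) (nbhs_filter p)) => e e0.
apply/nbhs_normP; exists e => // q pq.
by apply: le_lt_trans (sup_seminormB _ _) _; apply: le_lt_trans (sup_seminorm_le_norm _) _.
Qed.

Lemma sup_seminorm_lsc : weakstar_lower_semicontinuous sup_seminorm.
Proof.
move=> p a; rewrite lte_fin => ap.
have [n an] : exists n, a < `|p (z n) : R|.
  apply: contrapT => h; move: ap; apply/negP; rewrite -leNgt.
  by apply: sup_seminorm_le => n; rewrite leNgt; apply/negP => an; apply: h; exists n.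
exists [set q : weakstar Y | a < `|(q : dual Y) (z n) : R|].
  have h := cvg_norm (@weakstar_eval_continuous (z n) p).
  exact: (cvgr_gt _ (h (nbhs_filter p)) _ an).
by move=> q aq; rewrite lte_fin (lt_le_trans aq)// sup_seminorm_ub.
Qed.

Lemma sup_seminorm_small (T : Type) (F : set_system T) (f : T -> dual Y) (M : R) :
  Filter F -> (\forall t \near F, `|f t| <= M) ->
  (forall x, (f t x : R) @[t --> F] --> (0 : R)) ->
  forall e, 0 < e -> \forall t \near F, sup_seminorm (f t) <= e.
Proof.
move=> FF fM f0 e e0.
have [N MN] : exists N : nat, M * N.+1%:R^-1 <= e.
  have M1 : 0 < `|M| + 1 by rewrite ltr_wpDl.
  have eM : 0 < e / (`|M| + 1) by rewrite divr_gt0.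
  have [N _ H] := near_infty_natSinv_lt (PosNum eM).
  exists N; have /= := H N (leqnn N); rewrite ltr_pdivlMr// => h.
  apply: le_trans (ltW h); rewrite mulrC ler_wpM2l ?invr_ge0//.
  by rewrite (le_trans (ler_norm _))// lerDl.
have small : \forall t \near F, forall n, (n < N)%N -> `|f t (z n) : R| <= e.
  elim: N {MN} => [|N IH]; first by apply: nearW.
  have h := @cvgr0_norm_le _ _ _ _ _ _ (f0 (z N)) e e0.
  near=> t => n; rewrite ltnS leq_eqVlt => /predU1P[->|nN].
    by near: t; exact: h.
  by move: n nN; near: t.
near=> t; apply: sup_seminorm_le => n.
have [nN|Nn] := ltnP n N; first by move: n nN; near: t.
apply: (le_trans (ler_dual _ _)).
have ft : `|f t| <= M by near: t.
apply: le_trans MN; apply: ler_pM => //.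
by rewrite (le_trans (z_le n))// lef_pV2 ?posrE// ler_nat.
Unshelve. all: by end_near. Qed.

End SupSeminorm.
End WeakStarTopology.

(** * Metrizability and strong minima *)

Section Metrizability.
Context (R : realType) (Y : normedModType R) (z : nat -> Y).
Hypothesis z_le : forall n, `|z n| <= n.+1%:R^-1.
Context (K : set (dual Y)) (M : R).
Hypothesis K_compact : compact (K : set (weakstar Y)).
Hypothesis K_bounded : forall p, K p -> `|p| <= M.
Hypothesis z_separates : forall p q, K p -> K q -> (forall n, p (z n) = q (z n)) -> p = q.

Let h := sup_seminorm z.

Lemma sup_seminorm_separates p q : K p -> K q -> h (p - q) = 0 -> p = q.
Proof.
move=> Kp Kq hpq; apply: z_separates => // n; apply/eqP.
rewrite -subr_eq0 -[_ - _]/((p - q) (z n)) -normr_le0 -hpq.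
exact: sup_seminorm_ub.
Qed.

Lemma sup_seminormC (p q : dual Y) : h (p - q) = h (q - p).
Proof.
have [_ hZ] := sup_seminorm_seminorm z_le.
by rewrite -opprB -scaleN1r /h hZ normrN normr1 mul1r.
Qed.

Lemma sup_seminorm_nbhs (p : dual Y) e : K p -> 0 < e ->
  nbhs (p : weakstar Y) [set q | K q -> h (p - q) <= e].
Proof.
move=> Kp e0.
pose F : set_system (weakstar Y) := within K (nbhs (p : weakstar Y)).
have FF : Filter F by exact: within_filter.
apply: (@sup_seminorm_small R Y z z_le _ F (fun q => p - q) (M + M) FF) => //.
  apply: (@filterS _ _ (nbhs_filter (p : weakstar Y)) setT) filterT => q _ Kq.
  by rewrite (le_trans (ler_normB _ _))// lerD// K_bounded.
move=> x; apply/(@cvgrPdist_lt R R^o) => d d0.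
have := @weakstar_eval_continuous R Y x p.
move=> /(@cvgrPdist_lt R R^o _ _ (nbhs_filter (p : weakstar Y)))/(_ d d0) H.
apply: filterS H => q H Kq.
by rewrite sub0r normrN.
Qed.

(** On the weak* compact set K, the metric h (p - q) induces the weak* topology. *)
Lemma sup_seminorm_within (p : dual Y) : K p -> within K (nbhs (p : weakstar Y)) =
  filter_from [set e : R | 0 < e] (fun e => K `&` [set q : dual Y | h (p - q) < e]).
Proof.
have [hD hZ] := sup_seminorm_seminorm z_le.
move=> Kp; apply/seteqP; split=> [A pA|A [e /= e0 eA]]; last first.
  have e2 : 0 < e / 2 by rewrite divr_gt0.
  have := sup_seminorm_nbhs Kp e2; apply: filterS => q hq Kq; apply: eA; split=> //=.
  by rewrite (le_lt_trans (hq Kq))// ltr_pdivrMr// ltr_pMr// ltr1n.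
apply: contrapT => nA.
have /choice[y yE] : forall n, exists y : dual Y,
    [/\ K y, h (p - y) < n.+1%:R^-1 & ~ A y].
  move=> n; apply: contrapT => hn; apply: nA; exists n.+1%:R^-1 => /=.
    by rewrite invr_gt0.
  by move=> y [Ky hy]; apply: contrapT => nAy; apply: hn; exists y.
(* a cluster point of points of K tending to [p] for h can only be [p] *)
have [|q [Kq qcl]] := K_compact (F := (y : nat -> weakstar Y) @ \oo).
  by exists 0%N => // n _; have [] := yE n.
have clq (B : set (weakstar Y)) (N : nat) : nbhs q B -> exists2 n, (N <= n)%N & B (y n).
  move=> qB; have [||r [[n /= Nn <-] Br]] := qcl [set y n | n in [set n | (N <= n)%N]] B.
  - by exists N => // n /= Nn; exists n.
  - exact: qB.
  - by exists n.
have pq : p = q.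
  apply: sup_seminorm_separates => //; apply/eqP; rewrite eq_le sup_seminorm_ge0// andbT.
  apply/ler_addgt0Pr => e e0; rewrite add0r.
  have e2 : 0 < e / 2 by rewrite divr_gt0.
  have [N _ HN] := near_infty_natSinv_lt (PosNum e2).
  have [n Nn qn] := clq _ N (sup_seminorm_nbhs Kq e2).
  have [Ky py nAy] := yE n.
  have := hD (p - y n) (y n - q); rewrite addrA subrK.
  have := qn Ky; rewrite sup_seminormC => h1 h2.
  apply: (le_trans h2); rewrite (splitr e) lerD// ltW//.
  by apply: lt_trans py _; exact: (HN n Nn).
have [n _ An] := clq [set y | K y -> A y] 0%N ltac:(by rewrite -pq).
by have [Ky _ nAy] := yE n; apply: nAy; exact: An.
Qed.

Lemma separated_compact_metrizable : metrizable_set R (K : set (weakstar Y)).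
Proof.
have [hD hZ] := sup_seminorm_seminorm z_le.
have h0 : h 0 = 0 by have := hZ 0 0; rewrite scale0r normr0 mul0r.
exists (fun p q : dual Y => h (p - q)); split.
- move=> p q Kp Kq; split; first exact: sup_seminorm_separates.
  by move=> ->; rewrite subrr.
- by move=> p q _ _; exact: sup_seminormC.
- move=> p q r _ _ _; apply: le_trans (hD _ _).
  by rewrite addrA subrK.
exact: sup_seminorm_within.
Qed.

Lemma sup_seminorm_strong_minimum : K 0 -> weakstar_strong_minimum K h 0.
Proof.
move=> K0; have [hD hZ] := sup_seminorm_seminorm z_le.
have h0 : h 0 = 0 by have := hZ 0 0; rewrite scale0r normr0 mul0r.
split=> //.
  apply/eqP; rewrite eq_le; apply/andP; split; last by apply: ereal_inf_lbound; exists 0.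
  by apply: le_ereal_inf_tmp => _ [q Kq <-]; rewrite lee_fin h0 sup_seminorm_ge0.
move=> q Kq; rewrite h0 => hq A A0.
have : within K (nbhs ((0 : dual Y) : weakstar Y)) A by apply: filterS A0.
rewrite sup_seminorm_within// => -[e /= e0 eA].
have /cvgrPdist_lt/(_ e e0) H := hq.
apply: filterS H => n; rewrite sub0r normrN => hn; apply: eA; split=> //=.
by rewrite sup_seminormC subr0 (le_lt_trans (ler_norm _) hn).
Qed.

End Metrizability.

(** * Series of functionals with subprobability coefficients *)

Lemma big_ord_split (V : nmodType) (F : nat -> V) N n : (N <= n)%N ->
  \sum_(i < n) F i = \sum_(i < N) F i + \sum_(i < n - N) F (N + i)%N.
Proof. by move=> /subnKC; move: (n - N)%N => k <-; rewrite big_split_ord. Qed.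

Section SubconvexSeries.
Context (R : realType) (Y : normedModType R) (p : nat -> dual Y).
Hypothesis p1 : forall n, `|p n| = 1.
Hypothesis p0 : forall x, (p n x : R) @[n --> \oo] --> (0 : R).
Implicit Types (a : nat -> R) (r : dual Y) (x : Y).

(** Nonnegative coefficients of total mass at most 1. *)
Definition subprobability a : Prop :=
  (forall i, 0 <= a i) /\ forall n, \sum_(i < n) a i <= 1.

Definition partial_sum a n : dual Y := \sum_(i < n) a i *: p i.

(** r is the pointwise sum of the series of the a_i p_i. *)
Definition represents a r : Prop := forall x, (partial_sum a n x : R) @[n --> \oo] --> (r x : R).

(** The pointwise sums of the series with subprobability coefficients. *)
Definition subconvex_series : set (dual Y) :=
  [set r | exists2 a, subprobability a & represents a r].

Lemma partial_sum_diff a x e N n : (forall i, 0 <= a i) -> (N <= n)%N ->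
  (forall i, (N <= i)%N -> `|p i x : R| <= e) ->
  `|partial_sum a n x - partial_sum a N x : R| <= (\sum_(i < n) a i - \sum_(i < N) a i) * e.
Proof.
move=> a0 Nn pe; rewrite /partial_sum (big_ord_split a Nn).
rewrite (big_ord_split (fun i => a i *: p i) Nn) dualDE.
rewrite [X in `|X|]addrC addKr [X in X * _]addrC addKr dual_sumE mulr_suml.
apply: (le_trans (ler_norm_sum _ _ _)); apply: ler_sum => i _.
rewrite dualZE normrM ger0_norm// ler_wpM2l// pe//; exact: leq_addr.
Qed.

Lemma sum_subprobability_ge0 a n : subprobability a -> 0 <= \sum_(i < n) a i.
Proof. by move=> [a0 _]; exact: sumr_ge0. Qed.

Lemma represents_tail a r x e N : subprobability a -> represents a r -> 0 <= e ->
  (forall i, (N <= i)%N -> `|p i x : R| <= e) -> `|r x - partial_sum a N x : R| <= e.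
Proof.
move=> sa ra e0 pe; have [a0 a1] := sa.
have h : (`|partial_sum a n x - partial_sum a N x : R|) @[n --> \oo] -->
    `|r x - partial_sum a N x : R|.
  by apply: cvg_norm; apply: cvgB; [exact: ra|exact: cvg_cst].
apply: (real_cvg_le h); exists N => // n /= Nn.
apply: (le_trans (partial_sum_diff a0 Nn pe)); apply: ler_piMl => //.
by have := sum_subprobability_ge0 N sa; have := a1 n; lra.
Qed.

Lemma subconvex_term_le i x : `|p i x : R| <= `|x|.
Proof. by rewrite (le_trans (ler_dual _ _))// p1 mul1r. Qed.

Lemma represents_norm a r n d : subprobability a -> represents a r ->
  (forall m, (n <= m)%N -> \sum_(i < m) a i - \sum_(i < n) a i <= d) ->
  `|r - partial_sum a n| <= d.
Proof.
move=> sa ra ad; have d0 : 0 <= d by have := ad n (leqnn n); rewrite subrr.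
apply: dual_norm_leP => x x1.
have h : (`|partial_sum a m x - partial_sum a n x : R|) @[m --> \oo] -->
    `|r x - partial_sum a n x : R|.
  by apply: cvg_norm; apply: cvgB; [exact: ra|exact: cvg_cst].
apply: (real_cvg_le h); exists n => // m /= nm.
apply: (le_trans (partial_sum_diff (e := 1) sa.1 nm _)); last by rewrite mulr1 ad.
by move=> i _; exact: le_trans (subconvex_term_le i x) x1.
Qed.

Lemma subconvex_series_bounded r : subconvex_series r -> `|r| <= 1.
Proof.
move=> [a sa ra]; have := @represents_norm a r 0 1 sa ra.
rewrite /partial_sum !big_ord0 subr0; apply=> m _.
by rewrite ?big_ord0 subr0; exact: sa.2.
Qed.

Lemma subprobability_represents a : subprobability a -> exists r, represents a r.
Proof.
move=> sa; have [a0 a1] := sa.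
have [||x|r _ rE] := @pointwise_limit_dual R Y nat \oo (partial_sum a) 1.
- exact: ler01.
- apply: nearW => n; apply: dual_norm_leP => x x1.
  have := @partial_sum_diff a x 1 0 n a0 (leq0n n).
  rewrite /partial_sum !big_ord0 !subr0 mulr1 => h; apply: le_trans (h _) (a1 n).
  by move=> i _; exact: le_trans (subconvex_term_le i x) x1.
- have sE : (fun n => partial_sum a n x : R) = series (fun i => a i * (p i x : R)).
    apply/funext => n; rewrite /partial_sum dual_sumE /series/= big_mkord.
    by apply: eq_bigr.
  have /normed_cvg/cvg_ex[l hl] : cvgn [normed series (fun i => a i * (p i x : R))].
    apply: nondecreasing_is_cvgn; first by apply: nondecreasing_series => n _ _; exact: normr_ge0.
    exists `|x| => _ [n _ <-].
    rewrite -[X in X <= _]/(series (fun i => `|a i * (p i x : R)|) n) /series/= big_mkord.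
    apply: (@le_trans _ _ ((\sum_(i < n) a i) * `|x|)); last by rewrite ler_piMl.
    rewrite mulr_suml; apply: ler_sum => i _.
    by rewrite normrM ger0_norm// ler_wpM2l// subconvex_term_le.
  by exists l; rewrite sE.
by exists r.
Qed.

Lemma subconvex_series0 : subconvex_series 0.
Proof.
exists (fun=> 0); first by split=> // n; rewrite big1.
move=> x; apply: cvg_near_cst; apply: nearW => n.
by rewrite /partial_sum big1// => i _; rewrite scale0r.
Qed.

Lemma subconvex_series_finite a N : (forall i, 0 <= a i) -> \sum_(i < N) a i <= 1 ->
  subconvex_series (partial_sum a N).
Proof.
move=> a0 a1; pose b i := if (i < N)%N then a i else 0.
have bN n : (N <= n)%N -> forall (V : lmodType R) (v : nat -> V),
    \sum_(i < n) b i *: v i = \sum_(i < N) a i *: v i.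
  move=> Nn V v; rewrite -(subnKC Nn) big_split_ord /= [X in _ + X]big1 ?addr0.
    by apply: eq_bigr => i _; rewrite /b ltn_ord.
  by move=> i _; rewrite /b ltnNge leq_addr /= scale0r.
have b0 i : 0 <= b i by rewrite /b; case: ifP.
exists b.
  split=> // n.
  have bN' m : (N <= m)%N -> \sum_(i < m) b i = \sum_(i < N) a i.
    move=> Nm; rewrite -(subnKC Nm) big_split_ord /= [X in _ + X]big1 ?addr0.
      by apply: eq_bigr => i _; rewrite /b ltn_ord.
    by move=> i _; rewrite /b ltnNge leq_addr.
  apply: le_trans a1; rewrite -(bN' (maxn N n) (leq_maxl _ _)).
  rewrite -(subnKC (leq_maxr N n)) big_split_ord /= lerDl.
  by apply: sumr_ge0.
move=> x; apply: cvg_near_cst; exists N => // n Nn.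
by rewrite /partial_sum bN.
Qed.

Lemma subconvex_series_basis n : subconvex_series (p n).
Proof.
pose a (i : nat) : R := (i == n)%:R.
have sE : \sum_(i < n.+1) a i = 1.
  rewrite big_ord_recr /= big1 ?add0r /a ?eqxx// => i _.
  by rewrite /a lt_eqF// ltEnat/=.
have pE : p n = partial_sum a n.+1.
  rewrite /partial_sum big_ord_recr /= big1 ?add0r /a ?eqxx ?scale1r// => i _.
  by rewrite /a lt_eqF ?scale0r// ltEnat/=.
rewrite pE; apply: subconvex_series_finite; last by rewrite sE.
by move=> i; rewrite /a ler0n.
Qed.

Lemma subconvex_series_convex : convex_set subconvex_series.
Proof.
move=> r s t; rewrite !inE => -[a [a0 a1] ra] [b [b0 b1] sb].
have t0 : 0 <= t%:num by [].
have t1 : 0 <= 1 - t%:num by rewrite subr_ge0.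
exists (fun i => t%:num * a i + (1 - t%:num) * b i).
  split=> [i|n]; first by rewrite addr_ge0// mulr_ge0.
  rewrite big_split /= -!mulr_sumr.
  have := ler_wpM2l t0 (a1 n); have := ler_wpM2l t1 (b1 n); lra.
move=> x.
have -> : (fun n => partial_sum (fun i => t%:num * a i + (1 - t%:num) * b i) n x : R) =
    (fun n => t%:num * (partial_sum a n x : R) + (1 - t%:num) * (partial_sum b n x : R)).
  apply/funext => n; rewrite /partial_sum !dual_sumE !mulr_sumr -big_split /=.
  apply: eq_bigr => i _.
  rewrite -[LHS]/((t%:num * a i + (1 - t%:num) * b i) * (p i x : R)).
  rewrite -[RHS]/(t%:num * (a i * (p i x : R)) + (1 - t%:num) * (b i * (p i x : R))).
  by ring.
rewrite -[X in _ --> X]/(t%:num * (r x : R) + (1 - t%:num) * (s x : R)).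
by apply: cvgD; apply: cvgM; [exact: cvg_cst|exact: ra|exact: cvg_cst|exact: sb].
Qed.

Lemma subconvex_series_separable : norm_separable subconvex_series.
Proof.
(* the finite rational combinations lying in the set form the countable dense part *)
pose comb (c : seq rat) := partial_sum (fun i => ratr (nth 0%R c i)) (size c).
exists (subconvex_series `&` range comb).
  apply: sub_countable (subset_card_le (@subIsetr _ _ _)) _.
  exact: sub_countable (card_image_le comb [set: seq rat]) (countableP _).
split=> [r []//|r [a sa ra] B /nbhs_ballP[e /= e0 eB]].
have [a0 a1] := sa.
have e2 : 0 < e / 2 by rewrite divr_gt0.
have [N HN] : exists N, forall m, (N <= m)%N -> \sum_(i < m) a i - \sum_(i < N) a i <= e / 4.
  pose S := [set \sum_(i < n) a i | n in [set: nat]].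
  have hS : has_sup S by split; [exists (\sum_(i < 0) a i), 0%N|exists 1 => _ [n _ <-]].
  have e4 : 0 < e / 4 by rewrite divr_gt0.
  have [_ [N _ <-] hN] := sup_adherent e4 hS.
  exists N => m _; have : \sum_(i < m) a i <= sup S by apply: ub_le_sup; [exact: hS.2|exists m].
  by move: hN; lra.
have d0 : 0 < e / 4 / N.+1%:R by rewrite !divr_gt0.
have cex (i : nat) : exists c : rat,
    [/\ 0 <= (ratr c : R), (ratr c : R) <= a i & a i - ratr c <= e / 4 / N.+1%:R].
  have [ai|ai] := eqVneq (a i) 0.
    have r0 : ratr 0%R = 0 :> R by exact: (rmorph0 ratr).
    by exists 0%R; rewrite r0 ai subr0; split=> //; exact: ltW.
  have ai0 : 0 < a i by rewrite lt_def ai a0.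
  have [|q] := @rat_in_itvoo R (Num.max 0 (a i - e / 4 / N.+1%:R)) (a i).
    by rewrite gt_max ai0/= ltrBlDr ltrDl.
  rewrite in_itv/= gt_max -andbA => /and3P[q0 q1 q2].
  by exists q; split; [exact: ltW|exact: ltW|by rewrite lerBlDr -lerBlDl ltW].
have [c cE] := choice cex.
pose s := mkseq c N.
have combE : comb s = partial_sum (fun i => ratr (c i)) N.
  rewrite /comb size_mkseq; apply: eq_bigr => i _.
  by rewrite nth_mkseq.
have c0 i : 0 <= ratr (c i) :> R by have [] := cE i.
exists (comb s); split; last first.
  apply: eB; rewrite -ball_normE /=.
  have -> : r - comb s = (r - partial_sum a N) + (partial_sum a N - comb s).
    by rewrite addrA subrK.
  apply: (le_lt_trans (ler_normD _ _)).
  have h1 := represents_norm sa ra HN.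
  suff h2 : `|partial_sum a N - comb s| <= e / 4.
    apply: (@le_lt_trans _ _ (e / 4 + e / 4)); first exact: lerD.
    by lra.
  rewrite combE /partial_sum -sumrB; apply: (le_trans (ler_norm_sum _ _ _)).
  apply: (@le_trans _ _ (\sum_(i < N) e / 4 / N.+1%:R)).
    apply: ler_sum => i _; rewrite -scalerBl normrZ p1 mulr1.
    have [_ h h'] := cE i.
    by rewrite ger0_norm// subr_ge0.
  rewrite sumr_const card_ord -(mulr_natr (e / 4 / N.+1%:R) N) mulrAC.
  rewrite ler_pdivrMr// ler_pM2l ?divr_gt0//.
  by rewrite ler_nat.
split; last by exists s.
rewrite combE; apply: subconvex_series_finite => //.
apply: le_trans (a1 N); apply: ler_sum => i _.
by have [] := cE i.
Qed.

(** Along an ultrafilter the coefficients converge, and, the p_n being pointwise null,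
so do the sums. *)
Lemma subconvex_series_compact : compact (subconvex_series : set (weakstar Y)).
Proof.
rewrite compact_ultra => F FU FK.
have /choice[a aP] : forall r : dual Y, exists a, subconvex_series r ->
    subprobability a /\ represents a r.
  move=> r; have [[a sa ra]|h] := pselect (subconvex_series r); first by exists a.
  by exists (fun=> 0).
have FF : ProperFilter F by exact: ultra_proper.
have asum r n : subconvex_series r -> \sum_(i < n) a r i <= 1.
  by move=> /aP[[_ h] _]; exact: h.
have age0 r i : subconvex_series r -> 0 <= a r i by move=> /aP[[h _] _]; exact: h.
have /choice[al alE] : forall i, exists l : R, (a r i) @[r --> F] --> l.
  move=> i; apply: (@ultra_bounded_cvg R _ F (fun r => a r i) 1) => //.
  apply: filterS FK => r Kr; rewrite ger0_norm ?age0//.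
  apply: le_trans (asum r i.+1 Kr); rewrite big_ord_recr /= lerDr.
  by apply: sumr_ge0 => j _; exact: age0.
have sal : subprobability al.
  split=> [i|n].
    rewrite -oppr_le0; apply: (real_cvg_le (cvgN (alE i))).
    by apply: filterS FK => r Kr; rewrite oppr_le0 age0.
  have h : (\sum_(i < n) a r i) @[r --> F] --> \sum_(i < n) al i.
    exact: (@real_cvg_sum R _ F FF (fun i r => a r i) al n alE).
  apply: (real_cvg_le h); apply: filterS FK => r Kr; exact: asum.
have [q qE] := subprobability_represents sal.
exists q; split; first by exists al.
apply: (@weakstar_cvg R Y _ F id q) => x.
apply/(@cvgrPdist_le R R^o) => e e0.
have e3 : 0 < e / 3 by rewrite divr_gt0.
have /cvgrPdist_le/(_ (e / 3) e3)[N _ HN] := p0 x.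
have pN i : (N <= i)%N -> `|p i x : R| <= e / 3.
  by move=> /HN; rewrite sub0r normrN.
have h : (partial_sum (a r) N x : R) @[r --> F] --> (partial_sum al N x : R).
  rewrite /partial_sum dual_sumE; under eq_fun do rewrite dual_sumE.
  have hi i : (a r i * (p i x : R)) @[r --> F] --> al i * (p i x : R).
    by apply: cvgM; [exact: alE|exact: cvg_cst].
  exact: (@real_cvg_sum R _ F FF (fun i r => a r i * (p i x : R))
    (fun i => al i * (p i x : R)) N hi).
have h' := (@cvgrPdist_le R R^o _ F FF _ _).1 h _ e3.
suff H : F [set r : dual Y | `|(q x : R) - r x| <= e] by exact: H.
have FF' : @Filter (weakstar Y) F by exact: FF.
have Fh := @filterI (weakstar Y) F FF' _ _ FK h'.
apply: (@filterS (weakstar Y) F FF' _ _ _ Fh) => r [Kr hr].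
have [sa ra] := aP r Kr.
have h1 := represents_tail sal qE (ltW e3) pN.
have h2 := represents_tail sa ra (ltW e3) pN.
have qr : (q x : R) - r x = (q x - partial_sum al N x) +
   (partial_sum al N x - partial_sum (a r) N x) - (r x - partial_sum (a r) N x) by ring.
suff: `|(q x : R) - r x| <= e by []; rewrite qr.
apply: (le_trans (ler_normB _ _)); have -> : e = e / 3 + e / 3 + e / 3 by field.
apply: lerD => //; apply: (le_trans (ler_normD _ _)); exact: lerD.
Qed.

End SubconvexSeries.

(** * Limited operators *)

Section LimitedOperators.
Context (R : realType) (Y X : normedModType R).
Implicit Types (p : dual X) (T : {linear Y -> X}).

Lemma adjoint_dual T p : continuous T -> exists q : dual Y, forall y, q y = p (T y) :> R.
Proof.
move=> cT; have /linear_boundedP/pinfty_ex_gt0[M M0 TM] : bounded_near T (nbhs (0 : Y)).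
  exact/continuous_linear_bounded/cT.
have [||||q qE _] := @bounded_form_dual R Y (fun y => p (T y) : R) (`|p| * M).
- by rewrite mulr_ge0// ltW.
- by move=> x y; rewrite linearD dual_addr.
- by move=> a x; rewrite linearZ dual_scaler.
- by move=> x; rewrite (le_trans (ler_dual _ _))// -mulrA ler_wpM2l.
by exists q.
Qed.

(** The supremum in the definition of limited sets is the norm of the adjoint image. *)
Lemma ereal_sup_unit_ball T p (q : dual Y) : (forall y, q y = p (T y) :> R) ->
  ereal_sup [set `|p x|%:E | x in T @` @unit_ball R Y] = `|q|%:E.
Proof.
move=> qE; apply/eqP; rewrite eq_le; apply/andP; split.
  apply: ge_ereal_sup => _ [_ [y y1 <-] <-]; rewrite lee_fin -[p _]qE.
  exact: ler_dual_unit.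
set s := ereal_sup _.
have les y : `|y| <= 1 -> (`|q y : R|%:E <= s)%E.
  by move=> y1; apply: ereal_sup_ubound; exists (T y); [exists y|rewrite qE].
have h0 : (`|q 0 : R|%:E <= s)%E by apply: les; rewrite normr0.
case: s les h0 => [r||]//= les _; last by rewrite leey.
by rewrite lee_fin; apply: dual_norm_leP => y /les; rewrite lee_fin.
Qed.

Lemma limited_operatorP T (adj : dual X -> dual Y) :
  (forall p y, adj p y = p (T y) :> R) ->
  limited_operator T <-> forall p : nat -> dual X, weakstar_null p ->
    `|adj (p n)| @[n --> \oo] --> (0 : R).
Proof.
move=> adjE.
have eqs (p : nat -> dual X) : (fun n => ereal_sup [set `|p n x|%:E | x in T @` @unit_ball R Y]) =
    (fun n => `|adj (p n)|%:E).
  by apply/funext => n; apply: ereal_sup_unit_ball => y; rewrite adjE.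
split=> [lT p /lT|h p /h]; rewrite eqs; first by move/fine_cvgP => [].
by move=> p0; apply/fine_cvgP; split; [exact: nearW|exact: p0].
Qed.

(** An operator is limited when its adjoint maps weak* null sequences to norm null
ones; otherwise the images give a JN-sequence. *)
Lemma non_limited_JN T : continuous T -> ~ limited_operator T ->
  exists q : nat -> dual Y, JN_sequence q.
Proof.
move=> cT nT.
have /choice[adj adjE] : forall p, exists q : dual Y, forall y, q y = p (T y) :> R.
  by move=> p; exact: adjoint_dual.
move: nT => /(limited_operatorP adjE)/existsNP[p /not_implyP[/weakstar_nullP p0]].
move=> /cvgrPdist_lt/existsNP[e /not_implyP[e0 h]].
have /choice[k kE] : forall N, exists n, (N <= n)%N /\ e <= `|adj (p n)|.
  move=> N; apply: contrapT => hN; apply: h; exists N => // n /= Nn.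
  rewrite sub0r normrN normr_id ltNge; apply/negP => en; apply: hN.
  by exists n.
exists (fun n => adj (p (k n))); apply: (@JN_sequenceP _ _ _ e) => // [n|y].
  by have [] := kE n.
apply/(@cvgrPdist_lt R R^o) => d d0.
have /cvgrPdist_lt/(_ d d0)[N _ HN] := p0 (T y).
exists N => // n /= Nn; rewrite adjE.
by apply: HN; rewrite /= (leq_trans Nn)//; have [] := kE n.
Qed.

End LimitedOperators.

Section Assembly.
Context (R : realType) (Y : normedModType R).

Lemma JN_PGNF (p : nat -> dual Y) : JN_sequence p ->
  exists f : Y -> R^o, [/\ convex_function [set: convex_lmodType Y] f,
    continuous f & PGNF f].
Proof. by move=> /JN_normalized[q [q1 q0]]; exact: normalized_null_PGNF q0. Qed.

Lemma convex_PGNF_infinite_dimensional (f : Y -> R^o) :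
  convex_function [set: convex_lmodType Y] f -> PGNF f -> infinite_dimensional Y.
Proof.
move=> cf [x [Gf nF]]; apply: contrapT => nY; apply: nF.
exact: convex_Gateaux_Frechet.
Qed.

(** A minimizing sequence that is not norm null is weak* null. *)
Lemma strong_minima_non_limited (K : set (dual Y)) (h : dual Y -> R) :
  weakstar_strong_minimum K h 0 -> ~ norm_strong_minimum K h 0 ->
  ~ limited_operator (idfun : {linear Y -> Y}).
Proof.
move=> [K0 hinf hws] nns lid; apply: nns; split=> // q qK hq.
have qw := hws q qK hq.
have /(_ q qw) := (@limited_operatorP R Y Y idfun id (fun _ _ => erefl)).1 lid.
by move/norm_cvg0P.
Qed.

End Assembly.

(** * The equivalences *)

(** By uniform boundedness, weak* convergent sequences are bounded. *)
Lemma weakstar_cvg_bounded (R : realType) (Y : completeNormedModType R)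
    (p : nat -> dual Y) (q : dual Y) :
  (forall x, (p n x : R) @[n --> \oo] --> (q x : R)) ->
  exists M, forall n, `|p n| <= M.
Proof.
move=> pq.
have [f [n _ <-]|x|M HM] := @Banach_Steinhauss R Y R^o [set dual_fun (p n) | n in [set: nat]] _ _ 1.
- split; last exact: dual_linear.
  move=> r; exists (`|p n| * r) => x xr.
  by rewrite (le_trans (ler_dual _ _))// ler_wpM2l.
- have /cvg_seq_bounded/pinfty_ex_gt0[M M0 HM] : cvgn (fun n => p n x : R^o).
    by apply/cvg_ex; exists (q x); exact: pq.
  by exists M => _ [n _ <-]; exact: HM.
exists M => n; apply: dual_norm_leP => x x1.
by apply: (HM (dual_fun (p n))) => //; exists n.
Qed.

Lemma sup_seminorm_weakstar_continuous (R : realType) (Y : completeNormedModType R)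
    (z : nat -> Y) : (forall n, `|z n| <= n.+1%:R^-1) ->
  weakstar_sequentially_continuous (sup_seminorm z).
Proof.
move=> z_le p q /weakstar_cvgP pq.
have [M HM] := weakstar_cvg_bounded pq.
apply/(@cvgrPdist_le R R^o) => e e0.
have small := @sup_seminorm_small R Y z z_le nat \oo (fun n => q - p n) (`|q| + M) _ _ _ e e0.
near=> n; apply: (le_trans (sup_seminormB z_le _ _)); near: n.
apply: small.
  by apply: nearW => n; rewrite (le_trans (ler_normB _ _))// lerD2l.
move=> x; rewrite -(subrr (q x : R)).
by apply: cvgB; [exact: cvg_cst|exact: pq].
Unshelve. all: by end_near. Qed.

(** The set K is the set of subprobability combinations of a normalized JN-sequence; h
tends to 0 along that sequence, which does not tend to 0 in norm. *)
Lemma JN_strong_minima (R : realType) (Y : completeNormedModType R) (p : nat -> dual Y) :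
  JN_sequence p ->
  exists (K : set (dual Y)) (h : dual Y -> R),
         [/\ convex_set K, norm_separable K, weakstar_compact_metrizable K
           & K 0] /\
         [/\ seminorm h, continuous h, weakstar_lower_semicontinuous h
           & weakstar_sequentially_continuous h] /\
         weakstar_strong_minimum K h 0 /\ ~ norm_strong_minimum K h 0.
Proof.
move=> /JN_normalized[q [q1 q0]].
pose K := subconvex_series q.
have Ksep : norm_separable K := subconvex_series_separable q1.
have Kcomp : compact (K : set (weakstar Y)) := subconvex_series_compact q1 q0.
have Kbd r : K r -> `|r| <= 1 by exact: subconvex_series_bounded.
have [z [z_le zsep]] := norm_separable_separated Ksep.
have K0 : K 0 by exact: subconvex_series0.
have hcont := sup_seminorm_weakstar_continuous z_le.
exists K, (sup_seminorm z); split; last split; last split.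
- split => //; first exact: subconvex_series_convex.
  have Kmet := separated_compact_metrizable z_le Kcomp Kbd zsep.
  by split=> //; exact: Kmet.
- split; [exact: sup_seminorm_seminorm|exact: sup_seminorm_continuous|
    exact: sup_seminorm_lsc|exact: hcont].
- exact: (sup_seminorm_strong_minimum z_le Kcomp Kbd zsep).
move=> [_ _ H0]; have H := H0 q (subconvex_series_basis q).
have /H /cvgr0_norm_lt/(_ 1 ltr01)[N _ /(_ N (leqnn N))] :
    sup_seminorm z (q n) @[n --> \oo] --> sup_seminorm z 0.
  by apply: hcont; apply/weakstar_cvgP.
by rewrite /= q1 ltxx.
Qed.

Theorem theorem2 (R : realType) (Y : completeNormedModType R) :
  [<-> infinite_dimensional Y;
       exists p : nat -> dual Y, JN_sequence p;
       exists (K : set (dual Y)) (h : dual Y -> R),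
         [/\ convex_set K, norm_separable K, weakstar_compact_metrizable K
           & K 0] /\
         [/\ seminorm h, continuous h, weakstar_lower_semicontinuous h
           & weakstar_sequentially_continuous h] /\
         weakstar_strong_minimum K h 0 /\ ~ norm_strong_minimum K h 0;
       exists (X : completeNormedModType R) (T : {linear Y -> X}),
         continuous T /\ ~ limited_operator T;
       exists f : Y -> R^o,
         [/\ convex_function [set: convex_lmodType Y] f, continuous f
           & PGNF f]].
Proof.
tfae.
- move=> /Josefson_Nissenzweig[q [e [e0 qe q0]]].
  by exists q; exact: JN_sequenceP e0 qe q0.
- by move=> [p /JN_strong_minima].
- move=> [K [h [_ [_ [ws ns]]]]].
  exists Y, idfun; split; first by move=> x; exact: cvg_id.
  exact: strong_minima_non_limited ws ns.
- by move=> [X [T [cT nT]]]; have [q /JN_PGNF] := non_limited_JN cT nT.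
- by move=> [f [cf _ Pf]]; exact: convex_PGNF_infinite_dimensional cf Pf.
Qed.
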